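(* Let $\mathcal{S}$ be an essentially small triangulated category with an object $G$. (1) Suppose that $(\mathcal{S}^{\leq0},\mathcal{S}^{\geq0})$ is a bounded above $t$-structure on $\mathcal{S}$. Then the pair $\big(\mathfrak{S}_G(\mathcal{S}^{\leq0}),\mathfrak{S}_G(\mathcal{S}^{\geq0})\big)$ is a bounded above $t$-structure on $\mathfrak{S}_G(\mathcal{S})$ and has the same heart as $(\mathcal{S}^{\leq0},\mathcal{S}^{\geq0})$. (2) Suppose that $(\mathcal{S}^{\leq0},\mathcal{S}^{\geq0})$ is a bounded $t$-structure on $\mathcal{S}$. Then $\mathcal{S}\subseteq\mathfrak{S}_G(\mathcal{S})$. Further, if $\mathrm{findim}(\mathcal{S}^{\mathrm{op}},G^{\mathrm{op}})<\infty$, then $\mathcal{S}=\mathfrak{S}_G(\mathcal{S})$. (3) Suppose that $\mathrm{findim}(\mathcal{S}^{\mathrm{op}},G^{\mathrm{op}})<\infty$ and $\mathcal{X}$ is a full triangulated subcategory of $\mathfrak{S}_G(\mathcal{S})$ with $\mathcal{S}\subseteq\mathcal{X}$. Then all bounded $t$-structures on $\mathcal{X}$ are equivalent.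
   Context: Finitistic dimension. For an object $G$ of a triangulated category $\mathcal{S}$ (shift $[1]$) and $n\in\mathbb{Z}$, let $G(-\infty,n]:=\{G[-i]\mid i\leq n\}$. Let $\langle G\rangle^{(-\infty,n]}$ (resp. $\langle G\rangle^{[n,\infty)}$) be the smallest full subcategory of $\mathcal{S}$ containing $G[-n]$ and closed under extensions, direct summands and positive (resp. negative) shifts. For a class $\mathcal{A}$ of objects, $\mathcal{A}^{\perp}:=\{Y\in\mathcal{S}\mid \mathrm{Hom}_{\mathcal{S}}(A,Y)=0\ \forall A\in\mathcal{A}\}$. Put $\mathrm{findim}(\mathcal{S},G):=\inf\{n\in\mathbb{N}\mid G(-\infty,-1]^{\perp}\subseteq\langle G\rangle^{[0,\infty)}[n]\}$ ($\inf\emptyset=\infty$). $G^{\mathrm{op}}$ denotes $G$ viewed as an object of the opposite category $\mathcal{S}^{\mathrm{op}}$. Completion. A good metric on $\mathcal{S}$ is a sequence $\{\mathcal{M}_n\}_{n\in\mathbb{N}}$ of full subcategories containing $0$, each closed under extensions, with $\mathcal{M}_{n+1}[-1]\cup\mathcal{M}_{n+1}\cup\mathcal{M}_{n+1}[1]\subseteq\mathcal{M}_n$. Here we use the good metric $\mathcal{M}_n:=\langle G\rangle^{(-\infty,-n]}$. A Cauchy sequence is a sequence $X_0\xrightarrow{f_1}X_1\xrightarrow{f_2}X_2\to\cdots$ in $\mathcal{S}$ such that for every $i\geq 1$ there is $n_i\geq1$ with $\mathrm{Cone}(f_j)\in\mathcal{M}_i$ for all $j\geq n_i$. Let $\mathcal{S}\text{-Mod}$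 be the abelian category of additive functors $\mathcal{S}^{\mathrm{op}}\to\mathrm{Ab}$, $\mathfrak{y}(X)=\mathrm{Hom}_{\mathcal{S}}(-,X)$ the Yoneda functor, $(\Sigma F)(X)=F(X[-1])$. For a full subcategory $\mathcal{A}\subseteq\mathcal{S}$, $\mathfrak{S}_G(\mathcal{A})$ is the full subcategory of $\mathcal{S}\text{-Mod}$ of functors $F$ such that $F\cong\mathrm{colim}\,\mathfrak{y}(X_n)$ for some Cauchy sequence $\{X_n\}$ with all $X_n\in\mathcal{A}$, and $F(\mathcal{M}_j)=0$ for some $j\geq0$. $\mathfrak{S}_G(\mathcal{S})$ is the completion of $\mathcal{S}$ at $G$, a triangulated category with shift $\Sigma$ (Neeman); its triangles are the sequences $A\to B\to C\to\Sigma A$ in $\mathfrak{S}_G(\mathcal{S})$ isomorphic to the colimit of the image under $\mathfrak{y}$ of a Cauchy sequence of triangles in $\mathcal{S}$ (a sequence of morphisms of triangles $A_n\to B_n\to C_n\to A_n[1]$ in which $\{A_n\},\{B_n\},\{C_n\}$ are Cauchy). $\mathcal{S}$ and its full subcategories are identified with their essential images in $\mathcal{S}\text{-Mod}$ under $\mathfrak{y}$; this is the meaning of the equalities, inclusions and ''same heart''. $t$-structures. A $t$-structure on a triangulated category $\mathcal{X}$ is a pair of full subcategories $(\mathcal{X}^{\leq0},\mathcal{X}^{\geq0})$ such that, with $\mathcal{X}^{\leq n}:=\mathcal{X}^{\leq0}[-n]$, $\mathcal{X}^{\geq n}:=\mathcal{X}^{\geq0}[-n]$: $\mathcal{X}^{\leq-1}\subseteq\mathcal{X}^{\leq0}$,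 $\mathcal{X}^{\geq0}\subseteq\mathcal{X}^{\geq-1}$; $\mathrm{Hom}(\mathcal{X}^{\leq-1},\mathcal{X}^{\geq0})=0$; each $X$ fits into a triangle $X'\to X\to X''\to X'[1]$ with $X'\in\mathcal{X}^{\leq-1}$, $X''\in\mathcal{X}^{\geq0}$. The heart is $\mathcal{X}^{\leq0}\cap\mathcal{X}^{\geq0}$. It is bounded above if $\mathcal{X}=\bigcup_n\mathcal{X}^{\leq n}$, bounded below if $\mathcal{X}=\bigcup_n\mathcal{X}^{\geq-n}$, bounded if both. Two $t$-structures are equivalent if $\mathcal{X}_1^{\leq-n}\subseteq\mathcal{X}_2^{\leq0}\subseteq\mathcal{X}_1^{\leq n}$ for some $n\in\mathbb{N}$. *)

(* Defs.v *)
From HB Require Import structures.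
From mathcomp Require Import all_boot all_order all_algebra.
From mathcomp Require Import boolp.

Set Implicit Arguments.
Unset Strict Implicit.
Unset Printing Implicit Defensive.

Import GRing.Theory.
Local Open Scope ring_scope.

Record preadd := Preadd {
  ob :> Type;
  hom : ob -> ob -> zmodType;
  idm : forall X, hom X X;
  comp : forall X Y Z, hom Y Z -> hom X Y -> hom X Z;
  compA : forall X Y Z W (h : hom Z W) (g : hom Y Z) (f : hom X Y),
    comp h (comp g f) = comp (comp h g) f;
  comp1m : forall X Y (f : hom X Y), comp (idm Y) f = f;
  compm1 : forall X Y (f : hom X Y), comp f (idm X) = f;
  compDl : forall X Y Z (g g' : hom Y Z) (f : hom X Y),
    comp (g + g') f = comp g f + comp g' f;
  compDr : forall X Y Z (g : hom Y Z) (f f' : hom X Y),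
    comp g (f + f') = comp g f + comp g f' }.

Arguments hom {p} X Y.
Arguments idm {p} X.
Arguments comp {p X Y Z} g f.

Notation "g \c f" := (comp g f) (at level 40, left associativity).

Definition is_zero (C : preadd) (X : C) : Prop := idm X = 0.

Definition inverse_pair (C : preadd) (X Y : C) (f : hom X Y) (g : hom Y X) :
  Prop := g \c f = idm X /\ f \c g = idm Y.

Definition is_biproduct (C : preadd) (X Y P : C) : Prop :=
  exists (i1 : hom X P) (i2 : hom Y P) (p1 : hom P X) (p2 : hom P Y),
    [/\ p1 \c i1 = idm X, p2 \c i2 = idm Y, p2 \c i1 = 0, p1 \c i2 = 0
      & i1 \c p1 + i2 \c p2 = idm P].

Section OppositePreadd.
Variable C : preadd.

Definition op_preadd : preadd := @Preadd (ob C)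
  (fun X Y => hom Y X) (fun X => idm X) (fun X Y Z g f => f \c g)
  (fun X Y Z W h g f => esym (compA f g h))
  (fun X Y f => compm1 f) (fun X Y f => comp1m f)
  (fun X Y Z g g' f => compDr f g g') (fun X Y Z g f f' => compDl f f' g).

End OppositePreadd.

Record endofun (C : preadd) := Endofun {
  eob :> C -> C;
  emor : forall X Y, hom X Y -> hom (eob X) (eob Y);
  emor1 : forall X, emor (idm X) = idm (eob X);
  emorM : forall X Y Z (g : hom Y Z) (f : hom X Y),
    emor (g \c f) = emor g \c emor f;
  emorD : forall X Y (f f' : hom X Y), emor (f + f') = emor f + emor f' }.

Arguments emor {C} e {X Y} f.

Definition op_endofun (C : preadd) (T : endofun C) : endofun (op_preadd C) :=
  @Endofun (op_preadd C) (eob T) (fun X Y f => emor T f)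
    (fun X => emor1 T X) (fun X Y Z g f => emorM T f g)
    (fun X Y f f' => emorD T f f').

(* An additive category with an auto-equivalence [sh] (the shift [1]), a chosen
   quasi-inverse [shi] (the shift [-1]) related to it by an adjoint equivalence,
   and a class of candidate triangles X -> Y -> Z -> X[1].  A strict
   automorphism [1] is the case where [eta] and [eps] are identities. *)
Record tricat := Tricat {
  tcat :> preadd;
  sh : endofun tcat;
  shi : endofun tcat;
  eta : forall X : tcat, hom X (sh (shi X));
  eps : forall X : tcat, hom (shi (sh X)) X;
  dist : forall X Y Z : tcat, hom X Y -> hom Y Z -> hom Z (sh X) -> Prop;
  has_zero : exists Z : tcat, is_zero Z;
  has_biproduct : forall X Y : tcat, exists P, is_biproduct X Y P;
  eta_nat : forall (X Y : tcat) (f : hom X Y),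
    eta Y \c f = emor sh (emor shi f) \c eta X;
  eps_nat : forall (X Y : tcat) (f : hom X Y),
    f \c eps X = eps Y \c emor shi (emor sh f);
  eta_iso : forall X : tcat, exists g, inverse_pair (eta X) g;
  eps_iso : forall X : tcat, exists g, inverse_pair (eps X) g;
  eta_eps_sh : forall X : tcat, emor sh (eps X) \c eta (sh X) = idm (sh X);
  eta_eps_shi : forall X : tcat, eps (shi X) \c emor shi (eta X) = idm (shi X)
}.

Arguments sh {t}.
Arguments shi {t}.
Arguments eta {t} X.
Arguments eps {t} X.
Arguments dist {t X Y Z} f g h.

Record triangulated (S : tricat) : Prop := Triangulated {
  TR_iso : forall (X Y Z X' Y' Z' : S)
      (f : hom X Y) (g : hom Y Z) (h : hom Z (sh X))
      (f' : hom X' Y') (g' : hom Y' Z') (h' : hom Z' (sh X'))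
      (a : hom X X') (b : hom Y Y') (c : hom Z Z')
      (a' : hom X' X) (b' : hom Y' Y) (c' : hom Z' Z),
    dist f g h ->
    inverse_pair a a' -> inverse_pair b b' -> inverse_pair c c' ->
    b \c f = f' \c a -> c \c g = g' \c b -> emor sh a \c h = h' \c c ->
    dist f' g' h';
  TR1_id : forall X Z : S, is_zero Z ->
    dist (idm X) (0 : hom X Z) (0 : hom Z (sh X));
  TR1_cone : forall (X Y : S) (f : hom X Y),
    exists Z (g : hom Y Z) (h : hom Z (sh X)), dist f g h;
  TR2 : forall (X Y Z : S) (f : hom X Y) (g : hom Y Z) (h : hom Z (sh X)),
    dist f g h <-> dist g h (- emor sh f);
  TR3 : forall (X Y Z X' Y' Z' : S)
      (f : hom X Y) (g : hom Y Z) (h : hom Z (sh X))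
      (f' : hom X' Y') (g' : hom Y' Z') (h' : hom Z' (sh X'))
      (a : hom X X') (b : hom Y Y'),
    dist f g h -> dist f' g' h' -> b \c f = f' \c a ->
    exists c : hom Z Z', c \c g = g' \c b /\ emor sh a \c h = h' \c c;
  TR4 : forall (X Y Z Q1 Q2 Q3 : S) (f : hom X Y) (g : hom Y Z)
      (p1 : hom Y Q1) (d1 : hom Q1 (sh X))
      (p2 : hom Z Q2) (d2 : hom Q2 (sh X))
      (p3 : hom Z Q3) (d3 : hom Q3 (sh Y)),
    dist f p1 d1 -> dist (g \c f) p2 d2 -> dist g p3 d3 ->
    exists (a : hom Q1 Q2) (b : hom Q2 Q3),
      [/\ dist a b (emor sh p1 \c d3),
          a \c p1 = p2 \c g /\ d2 \c a = d1
        & b \c p2 = p3 /\ d3 \c b = emor sh f \c d2] }.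

Section OppositeFacts.
Variable S : tricat.

Fact op_has_biproduct (X Y : S) :
  exists P, is_biproduct (C := op_preadd S) X Y P.
Proof.
have [P [i1 [i2 [p1 [p2 [e1 e2 e3 e4 e5]]]]]] := has_biproduct X Y.
by exists P, p1, p2, i1, i2; split.
Qed.

Fact op_eps_iso (X : S) :
  exists g, inverse_pair (C := op_preadd S) (eps X : hom (p := op_preadd S) _ _) g.
Proof. by have [g [e1 e2]] := eps_iso X; exists g. Qed.

Fact op_eta_iso (X : S) :
  exists g, inverse_pair (C := op_preadd S) (eta X : hom (p := op_preadd S) _ _) g.
Proof. by have [g [e1 e2]] := eta_iso X; exists g. Qed.

End OppositeFacts.

(* In the opposite category the shift is [-1], and X -> Y -> Z -> X[-1] is
   distinguished when, read in S, X[-1] -> Z -> Y -> (X[-1])[1] is. *)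
Definition op (S : tricat) : tricat := @Tricat (op_preadd S)
  (op_endofun shi) (op_endofun sh) (fun X => eps X) (fun X => eta X)
  (fun (X Y Z : S) (f : hom Y X) (g : hom Z Y) (h : hom (shi X) Z) =>
     dist h g (eta X \c f))
  (has_zero S)
  (fun X Y => op_has_biproduct X Y)
  (fun (X Y : S) (f : hom Y X) => eps_nat f)
  (fun (X Y : S) (f : hom Y X) => eta_nat f)
  (fun X => op_eps_iso X) (fun X => op_eta_iso X)
  (fun X => eta_eps_shi X) (fun X => eta_eps_sh X).

(* The part of a category with shift and triangles that t-structures depend on.
   Hom-sets are pointed types rather than [zmodType]s because those of S-Mod
   need not be small when S is only essentially small. *)
Record tframe := TFrame {
  fob :> Type;
  fhom : fob -> fob -> Type;
  fid : forall X, fhom X X;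
  fcomp : forall X Y Z, fhom Y Z -> fhom X Y -> fhom X Z;
  fzero : forall X Y, fhom X Y;
  fsh : fob -> fob;
  fshi : fob -> fob;
  fdist : forall X Y Z, fhom X Y -> fhom Y Z -> fhom Z (fsh X) -> Prop }.

Arguments fhom {t} X Y.
Arguments fid {t} X.
Arguments fcomp {t X Y Z} g f.
Arguments fzero {t} X Y.
Arguments fsh {t} X.
Arguments fshi {t} X.
Arguments fdist {t X Y Z} f g h.

Definition frame (S : tricat) : tframe := @TFrame (ob S) (@hom S) (@idm S)
  (fun X Y Z g f => g \c f) (fun X Y => 0) sh shi (fun X Y Z => @dist S X Y Z).

Section TStructures.
Variable D : tframe.
Implicit Types (X Y Z : D) (P U V : D -> Prop).

Definition isomorphic X Y : Prop :=
  exists (f : fhom X Y) (g : fhom Y X),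
    fcomp g f = fid X /\ fcomp f g = fid Y.

Definition replete P : Prop := forall X Y, P X -> isomorphic X Y -> P Y.

Definition shift (X : D) (k : int) : D :=
  match k with
  | Posz n => iter n fsh X
  | Negz n => iter n.+1 fshi X
  end.

Definition sshift U (k : int) : D -> Prop :=
  fun Y => exists2 X, U X & isomorphic Y (shift X k).

Definition tle U (n : int) : D -> Prop := sshift U (- n).
Definition tge V (n : int) : D -> Prop := sshift V (- n).

(* (U, V) is a t-structure on the full triangulated subcategory P of D; as
   usual its aisle and coaisle are closed under isomorphism. *)
Record t_structure P U V : Prop := TStructure {
  ts_le_sub : forall X, U X -> P X;
  ts_ge_sub : forall X, V X -> P X;
  ts_le_replete : replete U;
  ts_ge_replete : replete V;
  ts_le : forall X, tle U (- 1) X -> tle U 0 X;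
  ts_ge : forall X, tge V 0 X -> tge V (- 1) X;
  ts_hom0 : forall X Y, tle U (- 1) X -> tge V 0 Y ->
    forall f : fhom X Y, f = fzero X Y;
  ts_triangle : forall X, P X ->
    exists X' X'' (u : fhom X' X) (v : fhom X X'') (w : fhom X'' (fsh X')),
      [/\ tle U (- 1) X', tge V 0 X'' & fdist u v w] }.

Definition bounded_above P U : Prop := forall X, P X -> exists n, tle U n X.
Definition bounded_below P V : Prop := forall X, P X -> exists n, tge V (- n) X.

Definition bounded_above_t_structure P U V : Prop :=
  t_structure P U V /\ bounded_above P U.

Definition bounded_t_structure P U V : Prop :=
  [/\ t_structure P U V, bounded_above P U & bounded_below P V].

Definition heart U V : D -> Prop := fun X => U X /\ V X.

Definition t_equivalent U1 U2 : Prop :=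
  exists n : nat, (forall X, tle U1 (- n%:Z) X -> tle U2 0 X) /\
                  (forall X, tle U2 0 X -> tle U1 n%:Z X).

Definition triangulated_subcategory P Q : Prop :=
  [/\ forall X, Q X -> P X,
      replete Q,
      exists2 Z, Q Z & fid Z = fzero Z Z,
      forall X, Q X -> Q (fsh X) /\ Q (fshi X)
    & forall X Y Z (u : fhom X Y) (v : fhom Y Z) (w : fhom Z (fsh X)),
        P Z -> fdist u v w -> Q X -> Q Y -> Q Z].

End TStructures.

Section Generation.
Variable S : tricat.
Implicit Types (G X Y Z : S) (P : S -> Prop).

Definition ext_closed P : Prop :=
  forall X Y Z (f : hom X Y) (g : hom Y Z) (h : hom Z (sh X)),
    dist f g h -> P X -> P Z -> P Y.

Definition summand_closed P : Prop :=
  forall X Y Z, is_biproduct X Y Z -> P Z -> P X.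

Definition fshift (X : S) (k : int) : S := shift (D := frame S) X k.

Definition gen_le G (n : int) : S -> Prop := fun X =>
  forall P, P (fshift G (- n)) -> ext_closed P -> summand_closed P ->
    (forall Y, P Y -> P (sh Y)) -> P X.

Definition gen_ge G (n : int) : S -> Prop := fun X =>
  forall P, P (fshift G (- n)) -> ext_closed P -> summand_closed P ->
    (forall Y, P Y -> P (shi Y)) -> P X.

Definition shifts_le G (n : int) : S -> Prop := fun X =>
  exists2 i : int, i <= n & X = fshift G (- i).

Definition right_perp P : S -> Prop := fun Y =>
  forall A, P A -> forall f : hom A Y, f = 0.

Definition findim_le G (n : nat) : Prop :=
  forall X, right_perp (shifts_le G (- 1)) X ->
    sshift (D := frame S) (gen_ge G 0) n%:Z X.

(* [None] stands for infinity. *)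
Definition findim G : option nat :=
  match pselect (exists n, `[< findim_le G n >]) with
  | left h => Some (ex_minn h)
  | right _ => None
  end.

End Generation.

Record smod (S : tricat) := SMod {
  mob :> S -> zmodType;
  mmor : forall X Y : S, hom X Y -> {additive mob Y -> mob X};
  mmor1 : forall (X : S) x, mmor (idm X) x = x;
  mmorM : forall (X Y Z : S) (g : hom Y Z) (f : hom X Y) x,
    mmor (g \c f) x = mmor f (mmor g x);
  mmorD : forall (X Y : S) (f f' : hom X Y) x,
    mmor (f + f') x = mmor f x + mmor f' x }.

Arguments mmor {S} s {X Y} f.

Record nt (S : tricat) (E F : smod S) := NT {
  nt_fun :> forall X : S, {additive E X -> F X};
  nt_nat : forall (X Y : S) (f : hom X Y) x,
    nt_fun X (mmor E f x) = mmor F f (nt_fun Y x) }.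

Section Modules.
Variable S : tricat.
Implicit Types E F H : smod S.

Definition nt_id_fun F (X : S) : F X -> F X := fun x => x.
Fact nt_id_fun_additive F X : GRing.zmod_morphism (@nt_id_fun F X).
Proof. by []. Qed.
HB.instance Definition _ F X :=
  GRing.isZmodMorphism.Build _ _ (@nt_id_fun F X) (@nt_id_fun_additive F X).
Definition nt_id F : nt F F :=
  @NT S F F (fun X => @nt_id_fun F X) (fun X Y f x => erefl).

Definition nt_comp_fun E F H (b : nt F H) (a : nt E F) (X : S) : E X -> H X :=
  fun x => b X (a X x).
Fact nt_comp_fun_additive E F H (b : nt F H) (a : nt E F) X :
  GRing.zmod_morphism (nt_comp_fun b a (X := X)).
Proof. by move=> x y; rewrite /nt_comp_fun !raddfB. Qed.
HB.instance Definition _ E F H (b : nt F H) (a : nt E F) X :=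
  GRing.isZmodMorphism.Build _ _ (@nt_comp_fun E F H b a X)
    (@nt_comp_fun_additive E F H b a X).
Fact nt_comp_nat E F H (b : nt F H) (a : nt E F) (X Y : S) (f : hom X Y) x :
  nt_comp_fun b a (mmor E f x) = mmor H f (nt_comp_fun b a x).
Proof. by rewrite /nt_comp_fun !nt_nat. Qed.
Definition nt_comp E F H (b : nt F H) (a : nt E F) : nt E H :=
  @NT S E H (fun X => @nt_comp_fun E F H b a X)
    (fun X Y f x => nt_comp_nat b a f x).

Definition nt_zero_fun E F (X : S) : E X -> F X := fun=> 0.
Fact nt_zero_fun_additive E F X : GRing.zmod_morphism (@nt_zero_fun E F X).
Proof. by move=> x y; rewrite /nt_zero_fun subr0. Qed.
HB.instance Definition _ E F X :=
  GRing.isZmodMorphism.Build _ _ (@nt_zero_fun E F X)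
    (@nt_zero_fun_additive E F X).
Fact nt_zero_nat E F (X Y : S) (f : hom X Y) x :
  @nt_zero_fun E F X (mmor E f x) = mmor F f (@nt_zero_fun E F Y x).
Proof. by rewrite /nt_zero_fun raddf0. Qed.
Definition nt_zero E F : nt E F :=
  @NT S E F (fun X => @nt_zero_fun E F X) (@nt_zero_nat E F).

Definition msh F : smod S := @SMod S (fun X => F (shi X))
  (fun X Y f => mmor F (emor shi f))
  (fun X x => etrans (congr1 (fun g => mmor F g x) (emor1 shi X)) (mmor1 x))
  (fun X Y Z g f x => etrans (congr1 (fun k => mmor F k x) (emorM shi g f))
     (mmorM (emor shi g) (emor shi f) x))
  (fun X Y f f' x => etrans (congr1 (fun k => mmor F k x) (emorD shi f f'))
     (mmorD (emor shi f) (emor shi f') x)).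

Definition mshi F : smod S := @SMod S (fun X => F (sh X))
  (fun X Y f => mmor F (emor sh f))
  (fun X x => etrans (congr1 (fun g => mmor F g x) (emor1 sh X)) (mmor1 x))
  (fun X Y Z g f x => etrans (congr1 (fun k => mmor F k x) (emorM sh g f))
     (mmorM (emor sh g) (emor sh f) x))
  (fun X Y f f' x => etrans (congr1 (fun k => mmor F k x) (emorD sh f f'))
     (mmorD (emor sh f) (emor sh f') x)).

Definition nt_sh E F (a : nt E F) : nt (msh E) (msh F) :=
  @NT S (msh E) (msh F) (fun X => a (shi X))
    (fun X Y f x => nt_nat a (emor shi f) x).

Fact compBl (X Y Z : S) (g g' : hom Y Z) (f : hom X Y) :
  (g - g') \c f = g \c f - g' \c f.
Proof. by apply/eqP; rewrite eq_sym subr_eq -compDl subrK. Qed.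

Fact compBr (X Y Z : S) (g : hom Y Z) (f f' : hom X Y) :
  g \c (f - f') = g \c f - g \c f'.
Proof. by apply/eqP; rewrite eq_sym subr_eq -compDr subrK. Qed.

Fact emorB (T : endofun S) (X Y : S) (f f' : hom X Y) :
  emor T (f - f') = emor T f - emor T f'.
Proof. by apply/eqP; rewrite eq_sym subr_eq -emorD subrK. Qed.

Definition precomp (Z X Y : S) (f : hom X Y) : hom Y Z -> hom X Z :=
  fun g => g \c f.
Fact precomp_additive (Z X Y : S) (f : hom X Y) :
  GRing.zmod_morphism (precomp (Z := Z) f).
Proof. by move=> g g'; exact: compBl. Qed.
HB.instance Definition _ (Z X Y : S) (f : hom X Y) :=
  GRing.isZmodMorphism.Build _ _ (@precomp Z X Y f) (@precomp_additive Z X Y f).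

Definition yo (Z : S) : smod S := @SMod S (fun X => hom X Z)
  (fun X Y f => @precomp Z X Y f)
  (fun X g => compm1 g) (fun X Y W g f k => compA k g f)
  (fun X Y f f' g => compDr g f f').

Definition postcomp (Z Z' : S) (k : hom Z Z') (X : S) : hom X Z -> hom X Z' :=
  fun g => k \c g.
Fact postcomp_additive (Z Z' : S) (k : hom Z Z') X :
  GRing.zmod_morphism (postcomp k (X := X)).
Proof. by move=> g g'; exact: compBr. Qed.
HB.instance Definition _ (Z Z' : S) (k : hom Z Z') X :=
  GRing.isZmodMorphism.Build _ _ (@postcomp Z Z' k X)
    (@postcomp_additive Z Z' k X).

Definition yom (Z Z' : S) (k : hom Z Z') : nt (yo Z) (yo Z') :=
  @NT S (yo Z) (yo Z') (fun X => @postcomp Z Z' k X)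
    (fun X Y f g => compA k g f).

(* The canonical isomorphism Hom(-, A[1]) -> Hom(-[-1], A). *)
Definition yo_sh_fun (A X : S) : hom X (sh A) -> hom (shi X) A :=
  fun g => eps A \c emor shi g.
Fact yo_sh_fun_additive (A X : S) : GRing.zmod_morphism (@yo_sh_fun A X).
Proof. by move=> g g'; rewrite /yo_sh_fun emorB compBr. Qed.
HB.instance Definition _ (A X : S) :=
  GRing.isZmodMorphism.Build _ _ (@yo_sh_fun A X) (@yo_sh_fun_additive A X).
Fact yo_sh_nat (A X Y : S) (f : hom X Y) (g : hom Y (sh A)) :
  yo_sh_fun (g \c f) = yo_sh_fun g \c emor shi f.
Proof. by rewrite /yo_sh_fun emorM compA. Qed.
Definition yo_sh (A : S) : nt (yo (sh A)) (msh (yo A)) :=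
  @NT S (yo (sh A)) (msh (yo A)) (fun X => @yo_sh_fun A X)
    (fun X Y f g => yo_sh_nat f g).

End Modules.

Section Completion.
Variables (S : tricat) (G : S).

Record sequence := Sequence {
  sob :> nat -> S;
  smor : forall n, hom (sob n) (sob n.+1) }.

Definition metric (n : nat) : S -> Prop := gen_le G (- n%:Z).

Definition cone_of (X Y : S) (f : hom X Y) (C : S) : Prop :=
  exists (g : hom Y C) (h : hom C (sh X)), dist f g h.

Definition cauchy (X : sequence) : Prop :=
  forall i, (1 <= i)%N -> exists n, forall j, (n <= j)%N ->
    exists2 C, cone_of (smor X j) C & metric i C.

Definition cocone (X : sequence) (F : smod S)
    (c : forall n, nt (yo (X n)) F) : Prop :=
  forall n, nt_comp (c n.+1) (yom (smor X n)) = c n.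

Definition is_colim (X : sequence) (F : smod S)
    (c : forall n, nt (yo (X n)) F) : Prop :=
  cocone c /\
  forall (H : smod S) (d : forall n, nt (yo (X n)) H), cocone d ->
    exists! u : nt F H, forall n, nt_comp u (c n) = d n.

Definition completion (A : S -> Prop) (F : smod S) : Prop :=
  (exists2 X : sequence, cauchy X & (forall n, A (X n)) /\
     exists c : forall n, nt (yo (X n)) F, is_colim c) /\
  (exists j, forall X, metric j X -> forall x : F X, x = 0).

Definition completion_all : smod S -> Prop := completion (fun _ => True).

Definition completion_dist (A B C : smod S)
    (u : nt A B) (v : nt B C) (w : nt C (msh A)) : Prop :=
  [/\ completion_all A, completion_all B & completion_all C] /\
  exists (X Y Z : sequence)
      (f : forall n, hom (X n) (Y n)) (g : forall n, hom (Y n) (Z n))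
      (h : forall n, hom (Z n) (sh (X n))),
    [/\ [/\ cauchy X, cauchy Y & cauchy Z],
        forall n, dist (f n) (g n) (h n),
        forall n, [/\ smor Y n \c f n = f n.+1 \c smor X n,
                      smor Z n \c g n = g n.+1 \c smor Y n
                    & emor sh (smor X n) \c h n = h n.+1 \c smor Z n]
      & exists (a : forall n, nt (yo (X n)) A) (b : forall n, nt (yo (Y n)) B)
            (c : forall n, nt (yo (Z n)) C),
          [/\ is_colim a, is_colim b, is_colim c
            & forall n,
              [/\ nt_comp u (a n) = nt_comp (b n) (yom (f n)),
                  nt_comp v (b n) = nt_comp (c n) (yom (g n))
                & nt_comp w (c n) =
                  nt_comp (nt_sh (a n))
                    (nt_comp (yo_sh (X n)) (yom (h n)))]]].

(* S-Mod with the shift and the triangles of the completion; the completion is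
   its full subcategory [completion_all]. *)
Definition completion_frame : tframe := @TFrame (smod S) (@nt S)
  (@nt_id S) (@nt_comp S) (@nt_zero S) (@msh S) (@mshi S) completion_dist.

Definition ess_image (A : S -> Prop) (F : smod S) : Prop :=
  exists2 X, A X & isomorphic (D := completion_frame) F (yo X).

End Completion.

(* Smallness refers to the universe of abelian groups in which the Hom-groups
   and the values of S-modules live. *)
Definition essentially_small (S : tricat) : Prop :=
  exists (I : Type@{Algebra.Zmodule.axioms_.u0}) (e : I -> S),
    forall X : S, exists i, isomorphic (D := frame S) X (e i).

(* Main.v *)
From HB Require Import structures.
From mathcomp Require Import all_boot all_order all_algebra.
From mathcomp Require Import boolp.
Require Import Defs.

Set Implicit Arguments.
Unset Strict Implicit.
Unset Printing Implicit Defensive.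

Import Order.TTheory GRing.Theory Num.Theory.
Local Open Scope ring_scope.

(** The theorem rests on the fact that the metric only sees very negative
    objects.  If a t-structure on S has G in some S^{<=a}, then the ball M_i
    lies in S^{<=a-i}, so that the cones in a Cauchy sequence sink below every
    level of the t-structure.

    Colimits of representable modules along a sequence are handled pointwise:
    a cocone is universal exactly when its maps are jointly surjective and an
    element dies in the colimit only if it dies at a finite stage
    ([is_colim_pw], [pw_is_colim]).  As a consequence a module F in the
    completion is cohomological on S, and the defining triangles are exact at
    each place when evaluated on S ([cdist_exactX], [cdist_exactY],
    [cdist_exactZ]).  Contravariantly, if H is in the completion, it kills some
    M_j, so the groups H(X_n) are eventually constant along a Cauchy sequence
    X: a map from colim X to H is the same as an element of H(X_n) for a single
    large n ([colim_extend], [colim_unique]).  Hence Hom(-, H) is exact on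
    triangles of the completion without any derived inverse limit
    ([cdist_out]).

    These facts, and their classical analogues in S, are recorded as
    [frame_laws]; they suffice for the usual characterisation of an aisle as the
    left orthogonal of a coaisle ([aisle_criterion]), which is used both in S
    and in the completion.

    Part (1).  A Cauchy sequence in S^{>=0} is eventually constant, because its
    far cones lie in S^{<=-2} and receive no non-zero map to S^{>=-1}; so the
    coaisle of the completion consists of the representables of S^{>=0}
    ([completion_coaisle]).  To truncate colim X_n, drop the terms whose cones
    are not negative enough, truncate X_0, and observe that X_0 -> X_0'' extends
    uniquely over the whole sequence.  The octahedral axiom says that the
    fibres X_n' of X_n -> X_0'' form a sequence with the same cones as X, so
    again a Cauchy sequence ([fiber_step], [completion_triangle]).

    Part (2).  If the t-structure is bounded below as well, every object of S is
    orthogonal to a ball, hence lies in the completion.  Finiteness of the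
    finitistic dimension of the opposite category says that an object with no
    maps to G[-k], for all k >= 1, lies in M_0[-d] ([findim_op_perp]).  So the
    aisle, shifted far enough, lies in M_j.  If F kills M_j, then F kills this
    shifted aisle, the negative part of a suitable truncation of F vanishes, and
    F is representable ([findim_ess_image]).

    Part (3).  Let F lie low enough in the first aisle.  Then Hom(F, G[-k]) = 0
    for all k >= 1; since a map X_n -> G[-k] extends to F = colim X_n for large
    n, the objects X_n themselves lie in M_0[-d].  But M_0 is generated by G by
    operations under which aisles are stable, so the X_n, and therefore F, lie
    in a fixed shift of the second aisle ([aisle_bound]). *)

(** * Additive and triangulated categories *)

Section Additive.
Variable C : preadd.
Implicit Types X Y Z W : C.

Lemma comp0m X Y Z (f : hom X Y) : (0 : hom Y Z) \c f = 0.
Proof. by apply: (addIr (0 \c f)); rewrite -compDl !add0r. Qed.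

Lemma compm0 X Y Z (g : hom Y Z) : g \c (0 : hom X Y) = 0.
Proof. by apply: (addIr (g \c 0)); rewrite -compDr !add0r. Qed.

Lemma compNm X Y Z (g : hom Y Z) (f : hom X Y) : (- g) \c f = - (g \c f).
Proof. by apply: (addIr (g \c f)); rewrite -compDl !addNr comp0m. Qed.

Lemma compmN X Y Z (g : hom Y Z) (f : hom X Y) : g \c (- f) = - (g \c f).
Proof. by apply: (addIr (g \c f)); rewrite -compDr !addNr compm0. Qed.

Lemma emor0 (T : endofun C) X Y : emor T (0 : hom X Y) = 0.
Proof. by apply: (addIr (emor T 0)); rewrite -emorD !add0r. Qed.

Lemma emorN (T : endofun C) X Y (f : hom X Y) : emor T (- f) = - emor T f.
Proof. by apply: (addIr (emor T f)); rewrite -emorD !addNr emor0. Qed.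

Lemma to_zero X Y (f : hom X Y) : is_zero Y -> f = 0.
Proof. by move=> zY; rewrite -(comp1m f) zY comp0m. Qed.

Lemma inverse_pair_sym X Y (f : hom X Y) g : inverse_pair f g ->
  inverse_pair g f.
Proof. by case. Qed.

Lemma inverse_pair_id X : inverse_pair (idm X) (idm X).
Proof. by split; rewrite comp1m. Qed.

Lemma inverse_pair_emor (T : endofun C) X Y (f : hom X Y) g :
  inverse_pair f g -> inverse_pair (emor T f) (emor T g).
Proof. by case=> e1 e2; split; rewrite -emorM (e1, e2) emor1. Qed.

Lemma biproduct_emor (T : endofun C) X Y Z :
  is_biproduct X Y Z -> is_biproduct (T X) (T Y) (T Z).
Proof.
case=> i1 [i2 [p1 [p2 [e1 e2 e3 e4 e5]]]].
exists (emor T i1), (emor T i2), (emor T p1), (emor T p2).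
by split; rewrite -?emorM -?emorD (e1, e2, e3, e4, e5) ?emor1 ?emor0.
Qed.

End Additive.

Section Triangulated.
Variables (S : tricat) (ST : triangulated S).
Implicit Types X Y Z W : S.

Lemma sh_faithful X Y (f : hom X Y) : emor sh f = 0 -> f = 0.
Proof.
move=> f0; have [g [_ e]] := eps_iso X.
by rewrite -(compm1 f) -e compA eps_nat f0 emor0 compm0 comp0m.
Qed.

Lemma shi_faithful X Y (f : hom X Y) : emor shi f = 0 -> f = 0.
Proof.
move=> f0; have [g [e _]] := eta_iso Y.
by rewrite -(comp1m f) -e -compA eta_nat f0 emor0 comp0m compm0.
Qed.

Lemma sh_inj X Y (f g : hom X Y) : emor sh f = emor sh g -> f = g.
Proof.
by move=> e; apply/eqP; rewrite -subr_eq0; apply/eqP/sh_faithful;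
  rewrite emorB e subrr.
Qed.

(** The shift is an equivalence: the preimage of f is its image under the
    inverse shift, conjugated by the counit. *)
Lemma sh_full X Y (f : hom (sh X) (sh Y)) : exists g : hom X Y, f = emor sh g.
Proof.
have [e' [e1 e2]] := eps_iso X.
exists (eps Y \c emor shi f \c e').
have [h [h1 h2]] := eta_iso (sh X).
have eh : h = emor sh (eps X).
  by rewrite -[LHS]comp1m -(eta_eps_sh X) -compA h2 compm1.
have e3 : emor sh e' = eta (sh X).
  by rewrite -(comp1m (emor sh e')) -h2 -compA eh -emorM e2 emor1 compm1.
by rewrite !emorM e3 -compA -eta_nat compA eta_eps_sh comp1m.
Qed.

(** Compare with the triangle X = X -> 0 through (id, f). *)
Lemma dist_zero X Y Z (f : hom X Y) (g : hom Y Z) h :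
  dist f g h -> g \c f = 0.
Proof.
move=> d; have [O zO] := has_zero S.
have [c [ec _]] := TR3 ST (TR1_id ST X zO) d
  (erefl : f \c idm X = f \c idm X).
by rewrite -ec compm0.
Qed.

Lemma dist_rot X Y Z (f : hom X Y) (g : hom Y Z) h :
  dist f g h -> dist g h (- emor sh f).
Proof. by move/(TR2 ST). Qed.

Lemma dist_zero2 X Y Z (f : hom X Y) (g : hom Y Z) h :
  dist f g h -> h \c g = 0.
Proof. by move/dist_rot/dist_zero. Qed.

Lemma dist_zero3 X Y Z (f : hom X Y) (g : hom Y Z) h :
  dist f g h -> emor sh f \c h = 0.
Proof.
by move/dist_rot/dist_zero2/eqP; rewrite compNm oppr_eq0 => /eqP.
Qed.

(** Hom(-, W) is exact on triangles: k is a map to the triangle 0 -> W = W. *)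
Lemma dist_out X Y Z W (f : hom X Y) (g : hom Y Z) h (k : hom Y W) :
  dist f g h -> k \c f = 0 -> exists l : hom Z W, k = l \c g.
Proof.
move=> d kf; have [O zO] := has_zero S.
have dW : dist (0 : hom O W) (idm W) (0 : hom W (sh O)).
  apply/(TR2 ST); rewrite emor0 oppr0; apply: TR1_id => //.
  by rewrite /is_zero -emor1 zO emor0.
have [|l [el _]] := TR3 ST d dW (a := 0) (b := k); first by rewrite kf comp0m.
by exists l; rewrite el comp1m.
Qed.

Lemma dist_out2 X Y Z W (f : hom X Y) (g : hom Y Z) h (k : hom Z W) :
  dist f g h -> k \c g = 0 -> exists l : hom (sh X) W, k = l \c h.
Proof. by move/dist_rot; apply: dist_out. Qed.

(** Hom(W, -) is exact on triangles: after one rotation, k is a map from the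
    triangle W -> 0 -> W[1], whose component at W[1] desuspends by fullness of
    the shift. *)
Lemma dist_in X Y Z W (f : hom X Y) (g : hom Y Z) h (k : hom W Y) :
  dist f g h -> g \c k = 0 -> exists l : hom W X, k = f \c l.
Proof.
move=> d kf; have [O zO] := has_zero S.
have dW := dist_rot (TR1_id ST W zO).
have [|c [_ ec]] := TR3 ST dW (dist_rot d) (a := k) (b := 0).
  by rewrite kf comp0m.
have [l el] := sh_full c.
exists l; apply: sh_inj; rewrite emorM -el.
by move: ec; rewrite emor1 compmN compm1 compNm => /oppr_inj.
Qed.

Lemma dist_in2 X Y Z W (f : hom X Y) (g : hom Y Z) h (k : hom W Z) :
  dist f g h -> h \c k = 0 -> exists l : hom W Y, k = g \c l.
Proof. by move/dist_rot; apply: dist_in. Qed.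

Lemma dist_in3 X Y Z W (f : hom X Y) (g : hom Y Z) h (k : hom W (sh X)) :
  dist f g h -> emor sh f \c k = 0 -> exists l : hom W Z, k = h \c l.
Proof.
by move=> /dist_rot d e; apply: (dist_in2 d); rewrite compNm e oppr0.
Qed.

Lemma dist_iso X Y Z (f : hom X Y) (g : hom Y Z) h :
  dist f g h -> is_zero Z -> exists f', inverse_pair f f'.
Proof.
move=> d zZ.
have [f' e1] : exists f', idm Y = f \c f'.
  by apply: (dist_in d); exact: to_zero.
exists f'; split=> //; apply/eqP; rewrite -subr_eq0; apply/eqP/sh_faithful.
have [|l ->] := dist_in3 (k := emor sh (f' \c f - idm X)) d.
  by rewrite -emorM compBr compA -e1 comp1m compm1 subrr emor0.
by rewrite (to_zero l zZ) compm0.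
Qed.

(** The five lemma, by diagram chase with generalised elements W -> Z. *)
Lemma dist_five X Y Z X' Y' Z' (f : hom X Y) (g : hom Y Z) h
    (f' : hom X' Y') (g' : hom Y' Z') h' (a : hom X X') (b : hom Y Y') a' b'
    (c : hom Z Z') :
  dist f g h -> dist f' g' h' -> inverse_pair a a' -> inverse_pair b b' ->
  b \c f = f' \c a -> c \c g = g' \c b -> emor sh a \c h = h' \c c ->
  exists c', inverse_pair c c'.
Proof.
move=> d d' [a1 a2] [b1 b2] e0 e1 e2.
have e0' : f \c a' = b' \c f'.
  by rewrite -(comp1m (f \c a')) -b1 -compA (compA b) e0 -!compA a2 compm1.
have mono W (k : hom W Z) : c \c k = 0 -> k = 0.
  move=> ck.
  have hk : h \c k = 0.
    rewrite -(comp1m (h \c k)) -emor1 -a1 emorM -compA (compA _ h k) e2.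
    by rewrite -compA ck !compm0.
  have [l el] := dist_in2 d hk.
  have [|m em] := dist_in (k := b \c l) d';
    first by rewrite compA -e1 -compA -el.
  rewrite el -(comp1m l) -b1 -compA em (compA b') -e0' -compA compA.
  by rewrite (dist_zero d) comp0m.
have lift W (k : hom W Z') : exists l, k = c \c l.
  have [|l el] := dist_in3 (k := emor sh a' \c (h' \c k)) d.
    by rewrite compA -emorM e0' emorM -compA (compA _ h') (dist_zero3 d') comp0m
      compm0.
  have [|n en] := dist_in2 (k := k - c \c l) d'.
    rewrite compBr (compA h') -e2 -compA -el compA -emorM a2 emor1 comp1m.
    by rewrite subrr.
  exists (l + g \c (b' \c n)).
  by rewrite compDr compA e1 -compA (compA b) b2 comp1m -en addrC subrK.
have [s es] := lift _ (idm Z').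
exists s; split=> //; apply/eqP; rewrite -subr_eq0; apply/eqP/mono.
by rewrite compBr compA -es comp1m compm1 subrr.
Qed.

(** Changing two of the three signs is an isomorphism of triangles. *)
Lemma dist_sign X Y Z (f : hom X Y) (g : hom Y Z) h :
  dist f g h -> dist f (- g) (- h).
Proof.
move=> d; have iN : inverse_pair (- idm Z) (- idm Z).
  by split; rewrite compNm compmN opprK comp1m.
apply: (TR_iso ST d (inverse_pair_id X) (inverse_pair_id Y) iN).
- by rewrite comp1m compm1.
- by rewrite compNm comp1m compm1.
- by rewrite emor1 comp1m compNm compmN opprK compm1.
Qed.

(** Three rotations shift a triangle and negate all three maps; two of the
    signs can be removed by an isomorphism. *)
Lemma dist_shE X Y Z (f : hom X Y) (g : hom Y Z) (h : hom Z (sh X)) :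
  dist f g h <-> dist (emor sh f) (emor sh g) (- emor sh h).
Proof.
have iN : inverse_pair (- idm (sh Y)) (- idm (sh Y)).
  by split; rewrite compNm compmN opprK comp1m.
rewrite 3!(TR2 ST); split=> d.
- apply: (TR_iso ST d (inverse_pair_id _) iN (inverse_pair_id _)).
  + by rewrite compNm compmN opprK comp1m compm1.
  + by rewrite !compmN comp1m compm1.
  + by rewrite emor1 comp1m compm1.
- apply: (TR_iso ST d (inverse_pair_id _) iN (inverse_pair_id _)).
  + by rewrite compNm comp1m compm1.
  + by rewrite compNm compmN opprK comp1m compm1.
  + by rewrite emor1 comp1m compm1.
Qed.

Lemma dist_shi X Y Z (f : hom X Y) (g : hom Y Z) h :
  dist f g h -> exists k, dist (emor shi f) (emor shi g) k.
Proof.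
move=> d; have [e1 i1] := eta_iso X; have [e2 i2] := eta_iso Y.
have [e3 i3] := eta_iso Z.
have [k ek] := sh_full (emor sh (eta X) \c h \c e3).
exists (- k); apply/dist_shE; rewrite emorN opprK.
apply: (TR_iso ST d i1 i2 i3); rewrite ?eta_nat //.
by rewrite -ek -compA (proj1 i3) compm1.
Qed.

Lemma cone_unique X Y Z X' Y' Z' (f : hom X Y) (g : hom Y Z) h
    (f' : hom X' Y') (g' : hom Y' Z') h' (a : hom X X') (b : hom Y Y') a' b' :
  dist f g h -> dist f' g' h' -> inverse_pair a a' -> inverse_pair b b' ->
  b \c f = f' \c a -> isomorphic (D := frame S) Z Z'.
Proof.
move=> d d' ia ib e; have [c [e1 e2]] := TR3 ST d d' e.
by have [c' ic] := dist_five d d' ia ib e e1 e2; exists c, c'.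
Qed.

Lemma cone_fiber Y Z Q (g : hom Y Z) (p : hom Z Q) d : dist g p d ->
  exists (f : hom (shi Q) Y) h, dist f g h.
Proof.
move=> dg; have [e ie] := eta_iso Q.
have [f ef] := sh_full (- (d \c e)).
exists f, (eta Q \c p); apply/(TR2 ST); rewrite -ef opprK.
apply: (TR_iso ST dg (inverse_pair_id _) (inverse_pair_id _) ie).
- by rewrite comp1m compm1.
- by rewrite compm1.
- by rewrite emor1 comp1m -compA (proj1 ie) compm1.
Qed.

Lemma fiber Y Z (g : hom Y Z) : exists X (f : hom X Y) h, dist f g h.
Proof.
have [Q [p [d dg]]] := TR1_cone ST g.
by have [f [h df]] := cone_fiber dg; exists (shi Q), f, h.
Qed.

(** If v : X -> T extends along f : X -> Y to r, the octahedron on r o f gives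
    a map between the fibres of v and r whose cone is the cone of f. *)
Lemma fiber_step X' X Y T C (u : hom X' X) (v : hom X T) w
    (f : hom X Y) (p : hom Y C) d (r : hom Y T) :
  dist u v w -> dist f p d -> r \c f = v ->
  exists Y' (u' : hom Y' Y) w' (f' : hom X' Y'),
    [/\ dist u' r w', f \c u = u' \c f', emor sh f' \c w = w'
      & cone_of f' C].
Proof.
move=> duv df rf; have [Y' [u' [w' dr]]] := fiber r.
have dv := dist_rot duv; rewrite -rf in dv.
have [a [b [dab [_ _] [bw e]]]] := TR4 ST df dv (dist_rot dr).
have [f' ef] := sh_full b; rewrite {}ef in dab bw e.
exists Y', u', w', f'; split=> //.
  apply: sh_inj; rewrite !emorM; apply/oppr_inj.
  by rewrite -compmN -e compNm.
exists (- (p \c u')), a; do 2![apply/(TR2 ST)].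
by rewrite emorN opprK emorM; move/dist_sign: dab; rewrite compmN opprK.
Qed.

End Triangulated.

(** * Shifts and t-structures, abstractly *)

Section FrameLaws.
Variables (D : tframe) (P : D -> Prop).
Implicit Types X Y Z W : D.

Definition hom_null X Y : Prop := forall f : fhom X Y, f = fzero X Y.

(** What the arguments on t-structures need from the ambient category. The
    predicate P restricts the objects for which Hom(-, W) is exact: in the
    category of modules the proof of exactness needs W in the completion. Maps
    form pointed sets, so faithfulness of the shifts is expressed by zero
    maps. *)
Record frame_laws : Prop := FrameLaws {
  fcompA : forall X Y Z W (h : fhom Z W) (g : fhom Y Z) (f : fhom X Y),
    fcomp h (fcomp g f) = fcomp (fcomp h g) f;
  fcomp1f : forall X Y (f : fhom X Y), fcomp (fid Y) f = f;
  fcompf1 : forall X Y (f : fhom X Y), fcomp f (fid X) = f;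
  fcomp0f : forall X Y Z (f : fhom X Y), fcomp (fzero Y Z) f = fzero X Z;
  fcompf0 : forall X Y Z (g : fhom Y Z), fcomp g (fzero X Y) = fzero X Z;
  fsh_iso : forall X Y, isomorphic X Y -> isomorphic (fsh X) (fsh Y);
  fshi_iso : forall X Y, isomorphic X Y -> isomorphic (fshi X) (fshi Y);
  fshK : forall X, isomorphic (fshi (fsh X)) X;
  fshiK : forall X, isomorphic (fsh (fshi X)) X;
  fsh_null : forall X Y, hom_null (fsh X) (fsh Y) -> hom_null X Y;
  fshi_null : forall X Y, hom_null (fshi X) (fshi Y) -> hom_null X Y;
  fdist_out : forall X Y Z W (u : fhom X Y) (v : fhom Y Z)
      (w : fhom Z (fsh X)) (f : fhom Z W),
    P W -> fdist u v w -> fcomp f v = fzero Y W ->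
    exists g : fhom (fsh X) W, f = fcomp g w;
  fdist_iso : forall X Y Z (u : fhom X Y) (v : fhom Y Z) (w : fhom Z (fsh X)),
    fdist u v w -> fid Z = fzero Z Z -> isomorphic X Y }.

Hypothesis L : frame_laws.

Lemma iso_refl X : isomorphic X X.
Proof. by exists (fid X), (fid X); rewrite (fcomp1f L). Qed.

Lemma iso_sym X Y : isomorphic X Y -> isomorphic Y X.
Proof. by case=> f [g [e1 e2]]; exists g, f. Qed.

Lemma iso_trans Y X Z : isomorphic X Y -> isomorphic Y Z -> isomorphic X Z.
Proof.
case=> f [f' [e1 e2]] [g [g' [e3 e4]]]; exists (fcomp g f), (fcomp f' g').
split.
  by rewrite (fcompA L) -(fcompA L f') e3 (fcompf1 L).
by rewrite (fcompA L) -(fcompA L g) e2 (fcompf1 L).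
Qed.

Lemma hom_null_iso X Y X' Y' :
  isomorphic X X' -> isomorphic Y Y' -> hom_null X Y -> hom_null X' Y'.
Proof.
case=> a [a' [_ a2]] [b [b' [_ b2]]] n f.
have e : f = fcomp (fcomp b b') (fcomp f (fcomp a a')).
  by rewrite a2 b2 (fcompf1 L) (fcomp1f L).
rewrite e (fcompA L f) -(fcompA L b) (fcompA L b') (n (fcomp b' _)).
by rewrite (fcomp0f L) (fcompf0 L).
Qed.

Lemma shiftS X (k : int) : isomorphic (shift X (k + 1)) (fsh (shift X k)).
Proof.
case: k => [n|[|n]].
- by rewrite [Posz n + 1]addrC -intS; apply: iso_refl.
- by apply/iso_sym/(fshiK L).
- have -> : Negz n.+1 + 1 = Negz n by rewrite !NegzE intS opprD addrC addNKr.
  exact/iso_sym/(fshiK L).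
Qed.

Lemma shiftP X (k : int) : isomorphic (shift X (k - 1)) (fshi (shift X k)).
Proof.
have := fshi_iso L (shiftS X (k - 1)); rewrite subrK => /iso_sym.
by apply: iso_trans; apply/iso_sym/(fshK L).
Qed.

Lemma shift_iso X Y k : isomorphic X Y -> isomorphic (shift X k) (shift Y k).
Proof.
by move=> i; case: k => n /=; [|apply: (fshi_iso L)];
  elim: n => //= n IHn; [apply: (fsh_iso L) | apply: (fshi_iso L)].
Qed.

Lemma shift_add X k l : isomorphic (shift (shift X k) l) (shift X (k + l)).
Proof.
elim/int_rect: l => [|n IHn|n IHn].
- by rewrite addr0; apply: iso_refl.
- rewrite intS [1 + _]addrC addrA; apply: iso_trans (shiftS _ _) _.
  exact: iso_trans (fsh_iso L IHn) (iso_sym (shiftS _ _)).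
- rewrite intS opprD [- 1 + _]addrC addrA; apply: iso_trans (shiftP _ _) _.
  exact: iso_trans (fshi_iso L IHn) (iso_sym (shiftP _ _)).
Qed.

Lemma shift_addE X k l m : k + l = m ->
  isomorphic (shift (shift X k) l) (shift X m).
Proof. by move=> <-; apply: shift_add. Qed.

Lemma sh_null X Y : hom_null (fsh X) (fsh Y) <-> hom_null X Y.
Proof.
split; first exact: (fsh_null L).
move=> n; apply: (fshi_null L).
by apply: hom_null_iso n; apply/iso_sym/(fshK L).
Qed.

Lemma shift_null X Y k : hom_null (shift X k) (shift Y k) <-> hom_null X Y.
Proof.
have shi_null A B : hom_null (fshi A) (fshi B) <-> hom_null A B.
  split; first exact: (fshi_null L).
  move=> n; apply: (fsh_null L).
  by apply: hom_null_iso n; apply/iso_sym/(fshiK L).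
by case: k => n /=; rewrite ?shi_null;
  elim: n => //= n IHn; rewrite ?sh_null ?shi_null.
Qed.

Lemma sshiftE U k X : replete U -> sshift U k X <-> U (shift X (- k)).
Proof.
move=> rU; split=> [[Y UY i]|UX].
  apply: rU UY _; apply: iso_sym; apply: iso_trans (shift_iso _ i) _.
  by apply: (@shift_addE _ _ _ 0); rewrite subrr.
exists (shift X (- k)) => //; apply: iso_sym.
by apply: (@shift_addE _ _ _ 0); rewrite addNr.
Qed.

(** Membership in a shifted aisle, moved to the object; this replaces the
    existential definition throughout. *)
Lemma tleE U n X : replete U -> tle U n X <-> U (shift X n).
Proof. by move=> rU; rewrite /tle sshiftE // opprK. Qed.

Lemma tgeE U n X : replete U -> tge U n X <-> U (shift X n).
Proof. exact: tleE. Qed.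

Section TStructure.
Variables Q U V : D -> Prop.
Hypotheses (QP : forall X, Q X -> P X) (Qsh : forall X, Q X -> Q (fsh X)).
Hypothesis T : t_structure Q U V.
Let rU := ts_le_replete T.
Let rV := ts_ge_replete T.

Lemma aisle_sh X : U X -> U (fsh X).
Proof.
move=> UX; have /(tleE _ _ rU) : tle U (- 1) (fsh X).
  by exists X => //; apply: iso_refl.
have := ts_le T; move/(_ (fsh X)); rewrite !(tleE _ _ rU) /= => H UY.
by apply: H.
Qed.

Lemma coaisle_shi X : V X -> V (fshi X).
Proof.
move=> VX; have := ts_ge T (X := X); rewrite !(tgeE _ _ rV) /=; exact.
Qed.

Lemma aisle_shift X (m n : int) : (m <= n)%R -> U (shift X m) -> U (shift X n).
Proof.
move=> le_mn UX; have [k ->] : exists k : nat, n = m + k%:Z.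
  by exists `|n - m|%N; rewrite gez0_abs ?subr_ge0 // [m + _]addrC subrK.
elim: k => [|k IHk]; first by rewrite addr0.
rewrite -addn1 PoszD addrA.
exact: rU (aisle_sh IHk) (iso_sym (shiftS _ _)).
Qed.

Lemma aisle_coaisle_null X Y (m n : int) : (m < n)%R ->
  U (shift X m) -> V (shift Y n) -> hom_null X Y.
Proof.
move=> lt_mn UX VY; apply/(shift_null _ _ n).
move=> f; apply: (ts_hom0 T) f; last by apply/(tgeE _ _ rV).
apply/(tleE _ _ rU); apply: rU (iso_sym (shift_add _ _ _)).
by apply: aisle_shift UX; rewrite -ltzD1 subrK.
Qed.

Lemma aisle_null X Y : U X -> V Y -> hom_null (fsh X) Y.
Proof.
move=> UX VY; apply: (@aisle_coaisle_null _ _ (-1) 0) => //.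
by apply: rU UX (iso_sym (fshK L _)).
Qed.

(** Truncate X[1] as X' -> X[1] -> X''. The second map vanishes, so the
    identity of X'' factors through X'[1]; but there is no non-zero map X'[1]
    -> X'', so X'' = 0 and X[1] is isomorphic to X'. *)
Lemma aisle_criterion0 X : Q X ->
  (forall H, V H -> hom_null (fsh X) H) -> U X.
Proof.
move=> QX XV.
have [X' [X'' [u [v [w [UX' VX'' d]]]]]] := ts_triangle T (Qsh QX).
have {}VX'' : V X'' by move/(tgeE _ _ rV): VX''.
have {}UX' : U (fshi X') by move/(tleE _ _ rU): UX'.
have v0 : v = fzero _ _ by apply: XV.
have [|g eg] := fdist_out L (f := fid X'') (QP (ts_ge_sub T VX'')) d.
  by rewrite (fcomp1f L) v0.
have g0 : g = fzero _ _.
  have n0 : hom_null (fsh X') X''.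
    apply: (aisle_coaisle_null (m := - 2) (n := 0)) => //.
    apply: rU UX' _; apply: (fshi_iso L).
    exact/iso_sym/(fshK L).
  exact: n0.
have i : isomorphic X' (fsh X).
  by apply: fdist_iso L _ _ _ _ _ _ d _; rewrite eg g0 (fcomp0f L).
apply: rU UX' _; apply: iso_trans (fshi_iso L i) (fshK L _).
Qed.

Lemma aisle_criterion X (n : int) : Q (shift X n) ->
  (forall H, V (shift H (n + 1)) -> hom_null X H) -> U (shift X n).
Proof.
move=> QX XV; apply: aisle_criterion0 => // H VH.
have e : hom_null X (shift H (- (n + 1))).
  apply: XV; apply: rV VH (iso_sym _).
  by apply: (@shift_addE _ _ _ 0); rewrite addNr.
move/(shift_null _ _ (n + 1)): e; apply: hom_null_iso; first exact: shiftS.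
by apply: (@shift_addE _ _ _ 0); rewrite addNr.
Qed.

End TStructure.
End FrameLaws.

(** * The metric defined by an object *)

Section Metric.
Variables (S : tricat) (ST : triangulated S).
Implicit Types X Y Z W : S.

Lemma frame_laws_tricat : frame_laws (D := frame S) (fun _ => True).
Proof.
split=> /=.
- by move=> X Y Z W h g f; rewrite compA.
- by move=> X Y f; rewrite comp1m.
- by move=> X Y f; rewrite compm1.
- by move=> X Y Z f; rewrite comp0m.
- by move=> X Y Z f; rewrite compm0.
- by move=> X Y [f [g i]]; exists (emor sh f), (emor sh g);
    apply: inverse_pair_emor.
- by move=> X Y [f [g i]]; exists (emor shi f), (emor shi g);
    apply: inverse_pair_emor.
- by move=> X; have [g i] := eps_iso X; exists (eps X), g.
- by move=> X; have [g i] := eta_iso X; exists g, (eta X);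
    apply: inverse_pair_sym.
- by move=> X Y n f; apply/sh_faithful/n.
- by move=> X Y n f; apply/shi_faithful/n.
- by move=> X Y Z W u v w f _ d; apply: (dist_out2 ST d).
- move=> X Y Z u v w d zZ; have [u' i] := dist_iso ST d zZ.
  by exists u, u'.
Qed.

Let L := frame_laws_tricat.

Lemma summand_closed_iso (P : S -> Prop) X Y :
  summand_closed P -> isomorphic (D := frame S) X Y -> P X -> P Y.
Proof.
move=> sP [f [g [/= e1 e2]]]; have [O zO] := has_zero S.
apply: (sP Y O X); exists g, 0, f, 0.
by split; rewrite ?comp0m ?compm0 ?addr0 ?zO.
Qed.

Variable G : S.

Lemma metric_gen i : metric G i (iter i sh G).
Proof. by move=> P; rewrite opprK. Qed.
Arguments metric_gen i : clear implicits.

Lemma metric_ext i : ext_closed (metric G i).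
Proof.
move=> X Y Z f g h d MX MZ P pG pe ps psh.
by apply: (pe _ _ _ _ _ _ d); [apply: MX | apply: MZ].
Qed.

Lemma metric_summand i : summand_closed (metric G i).
Proof.
by move=> X Y Z b MZ P pG pe ps psh; apply: (ps _ _ _ b); apply: MZ.
Qed.

Arguments metric_ext i : clear implicits.
Arguments metric_summand i : clear implicits.

Lemma metric_iso i X Y :
  isomorphic (D := frame S) X Y -> metric G i X -> metric G i Y.
Proof. exact: (summand_closed_iso (metric_summand i)). Qed.

Lemma metric_sh i X : metric G i X -> metric G i (sh X).
Proof. by move=> MX P pG pe ps psh; apply: (psh); apply: MX. Qed.
Arguments metric_sh {i X} _.

(** Induction on the generation of M_i, with the generator written as an
    iterated shift rather than with a doubly negated exponent. *)
Lemma metric_ind i (P : S -> Prop) : P (iter i sh G) -> ext_closed P ->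
  summand_closed P -> (forall Y, P Y -> P (sh Y)) ->
  forall X, metric G i X -> P X.
Proof. by move=> pG pe ps psh X; apply; rewrite // opprK. Qed.

Lemma metric_zero i X : is_zero X -> metric G i X.
Proof.
move=> zX; set Gi := iter i sh G.
apply: (metric_summand i X Gi Gi _ (metric_gen i)).
exists 0, (idm _), 0, (idm _).
by split; rewrite ?comp0m ?compm0 ?comp1m ?add0r ?zX.
Qed.

Lemma metric_mono i j X : (i <= j)%N -> metric G j X -> metric G i X.
Proof.
move=> le_ij; apply: (metric_ind (P := metric G i)) X => [||| Y].
- elim: j le_ij => [|j IHj]; first by rewrite leqn0 => /eqP->;
    apply: metric_gen.
  rewrite leq_eqVlt => /predU1P[->|]; first exact: metric_gen.
  by rewrite ltnS => /IHj/metric_sh.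
- exact: metric_ext.
- exact: metric_summand.
- exact: metric_sh.
Qed.

Lemma metric_shS i X : metric G i X -> metric G i.+1 (sh X).
Proof.
apply: (metric_ind (P := fun X => metric G i.+1 (sh X))) X =>
  [|X Y Z f g h|X Y Z b|Y].
- exact: (metric_gen i.+1).
- by move/(dist_shE ST); apply: metric_ext.
- by apply: metric_summand; apply: biproduct_emor b.
- exact: metric_sh.
Qed.

Lemma metric_shi i X : metric G i.+1 X -> metric G i (shi X).
Proof.
apply: (metric_ind (P := fun X => metric G i (shi X))) X =>
  [|X Y Z f g h|X Y Z b|Y].
- exact: metric_iso (iso_sym (fshK L _)) (metric_gen i).
- by case/(dist_shi ST)=> k; apply: metric_ext.
- by apply: metric_summand; apply: biproduct_emor b.
- move/metric_sh; apply: metric_iso.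
  apply: (iso_trans L) (fshiK L _) (iso_sym (fshK L _)).
Qed.

Lemma metric_iter i X : metric G 0 X -> metric G i (iter i sh X).
Proof. by move=> MX; elim: i => //= i IHi; exact: metric_shS IHi. Qed.

Lemma cone_metric_shi i X Y (f : hom X Y) C :
  cone_of f C -> metric G i.+1 C ->
  exists2 C', cone_of (emor shi f) C' & metric G i C'.
Proof.
case=> g [h d] MC; have [k dk] := dist_shi ST d.
by exists (shi C); [exists (emor shi g), k | apply: metric_shi].
Qed.

Lemma cone_metric_sh i X Y (f : hom X Y) C :
  cone_of f C -> metric G i C ->
  exists2 C', cone_of (emor sh f) C' & metric G i C'.
Proof.
case=> g [h d] MC; exists (sh C); last exact: metric_sh.
by exists (emor sh g), (- emor sh h); exact: (proj1 (dist_shE ST _ _ _) d).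
Qed.

(** In the opposite category the shift is inverted, so the objects G[-i] with i
    < 0 become the G[-k] of S with k > 0, the subcategory generated by G under
    negative shifts becomes M_0, and [d] becomes [-d]. *)
Lemma findim_op_perp : findim (S := op S) G <> None ->
  exists d, forall X, (forall k, (0 < k)%N ->
      hom_null (D := frame S) X (iter k shi G)) ->
    exists2 W, metric G 0 W & isomorphic (D := frame S) X (iter d shi W).
Proof.
rewrite /findim; case: pselect => // [[d /asboolP fd] _].
exists d => X nX; have [|W MW [f [g [/= e1 e2]]]] := fd X.
  move=> A [i le_i ->] f; case: i le_i f => [|k] // _ f.
  exact: (nX k.+1).
exists W; last by exists g, f.
move=> P; rewrite opprK => pG pe ps psh; apply: MW => //.
- move=> A B C f' g' h' /= dop PA PC.
  apply: (pe _ _ _ _ _ _ (dist_rot ST dop)) => //.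
  by apply: summand_closed_iso ps (iso_sym (fshiK L A)) PA.
- move=> A B C [i1 [i2 [p1 [p2 [b1 b2 b3 b4 b5]]]]]; apply: ps.
  by exists p1, p2, i1, i2.
Qed.

End Metric.

(** * Direct limits of abelian groups *)

Local Open Scope quotient_scope.

Section DirectLimit.
Variables (A : nat -> zmodType) (t : forall n m, A n -> A m).
Hypothesis t_add : forall n m x y, (n <= m)%N ->
  t m (x + y : A n) = t m x + t m y.
Hypothesis t_id : forall n (x : A n), t n x = x.
Hypothesis t_comp : forall n m k (x : A n), (n <= m)%N -> (m <= k)%N ->
  t k (t m x) = t k x.

Definition dl_rel (x y : {n & A n}) : bool :=
  `[< exists k, [/\ (tag x <= k)%N, (tag y <= k)%N
                  & t k (tagged x) = t k (tagged y)] >].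

Lemma dl_refl : reflexive dl_rel.
Proof. by move=> x; apply/asboolP; exists (tag x). Qed.

Lemma dl_sym : symmetric dl_rel.
Proof.
by move=> x y; apply/asboolP/asboolP=> -[k [? ? e]]; exists k.
Qed.

Lemma dl_trans : transitive dl_rel.
Proof.
move=> y x z /asboolP[k [xk yk e]] /asboolP[l [yl zl e']]; apply/asboolP.
exists (maxn k l); split; try by rewrite leq_max ?xk ?zl ?orbT.
rewrite -(t_comp _ xk) ?leq_maxl // e t_comp ?leq_maxl //.
by rewrite -(t_comp _ yl) ?leq_maxr // e' t_comp ?leq_maxr.
Qed.

Canonical dl_equiv := EquivRel dl_rel dl_refl dl_sym dl_trans.

Definition dl := {eq_quot dl_rel}%qT.
HB.instance Definition _ := EqQuotient.on dl.
HB.instance Definition _ := Choice.on dl.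

Definition din n (x : A n) : dl := \pi_dl (existT _ n x).

Lemma din_eq n m (x : A n) (y : A m) : din x = din y <->
  exists k, [/\ (n <= k)%N, (m <= k)%N & t k x = t k y].
Proof.
split=> [/eqmodP/asboolP//|e]; apply/eqmodP; exact/asboolP.
Qed.

Lemma din_surj (q : dl) : exists n (x : A n), q = din x.
Proof.
by exists (tag (repr q)), (tagged (repr q)); rewrite /din;
  case: (repr q) (reprK q).
Qed.

Lemma din_t n m (x : A n) : (n <= m)%N -> din (t m x) = din x.
Proof. by move=> le_nm; apply/din_eq; exists m; rewrite t_id. Qed.

Lemma din_surj2 (q r : dl) : exists n (x y : A n), q = din x /\ r = din y.
Proof.
have [n [x ->]] := din_surj q; have [m [y ->]] := din_surj r.
by exists (maxn n m), (t _ x), (t _ y); rewrite !din_t ?leq_maxl ?leq_maxr.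
Qed.

Let add (q r : dl) : dl :=
  let n := maxn (tag (repr q)) (tag (repr r)) in
  din (t n (tagged (repr q)) + t n (tagged (repr r))).
Let opp (q : dl) : dl := din (- tagged (repr q)).

Let repr_din n (x : A n) : exists k,
  [/\ (tag (repr (din x)) <= k)%N, (n <= k)%N
    & t k (tagged (repr (din x))) = t k x].
Proof.
apply/(din_eq (tagged (repr (din x))) x).
by rewrite -[RHS]reprK /din; case: (repr _).
Qed.

Let add_din n (x y : A n) : add (din x) (din y) = din (x + y).
Proof.
have [k [k1 k2 ek]] := repr_din x; have [l [l1 l2 el]] := repr_din y.
rewrite /add; move: (repr (din x)) (repr (din y)) k1 l1 ek el.
move=> [a u] [b v] /= k1 l1 ek el.
have kM := leq_maxl k l; have lM := leq_maxr k l.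
have mM : (maxn a b <= maxn k l)%N.
  by rewrite geq_max (leq_trans k1 kM) (leq_trans l1 lM).
have nM := leq_trans k2 kM.
apply/din_eq; exists (maxn k l); split=> //.
rewrite t_add // t_add // !(t_comp _ _ mM) ?leq_maxl ?leq_maxr //.
by rewrite -(t_comp _ k1 kM) ek -(t_comp _ l1 lM) el !t_comp.
Qed.

Let t0 n m : (n <= m)%N -> t m (0 : A n) = 0.
Proof. by move=> le_nm; apply: (addIr (t m (0 : A n)));
  rewrite -t_add // !add0r. Qed.

Let tN n m (x : A n) : (n <= m)%N -> t m (- x) = - t m x.
Proof.
by move=> le_nm; apply: (addIr (t m x)); rewrite -t_add // !addNr t0.
Qed.

Let opp_din n (x : A n) : opp (din x) = din (- x).
Proof.
have [k [k1 k2 ek]] := repr_din x.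
by apply/din_eq; exists k; rewrite !tN // ek.
Qed.

Let din0 n : din (0 : A n) = din (0 : A 0).
Proof. by rewrite -(din_t _ (leq0n n)) t0. Qed.

Let addA : associative add.
Proof.
move=> p q r; have [n [x [y [-> ->]]]] := din_surj2 p q.
have [m [z ->]] := din_surj r.
rewrite -(din_t x (leq_maxl n m)) -(din_t y (leq_maxl n m)).
by rewrite -(din_t z (leq_maxr n m)) !add_din addrA.
Qed.

Let addC : commutative add.
Proof.
by move=> p q; have [n [x [y [-> ->]]]] := din_surj2 p q;
  rewrite !add_din addrC.
Qed.

Let add0 : left_id (din (0 : A 0)) add.
Proof.
by move=> p; have [n [x ->]] := din_surj p; rewrite -(din0 n) add_din add0r.
Qed.

Let addN : left_inverse (din (0 : A 0)) opp add.
Proof.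
move=> p; have [n [x ->]] := din_surj p.
by rewrite opp_din add_din addNr din0.
Qed.

HB.instance Definition _ := GRing.isZmodule.Build dl addA addC add0 addN.

Lemma din_add n (x y : A n) : din (x + y) = din x + din y.
Proof. by rewrite -add_din. Qed.

(** The direct limit with its universal data, free of the quotient used to
    build it. *)
Lemma direct_limit_ex : exists (L : zmodType) (i : forall n, A n -> L),
  [/\ forall n x y, i n (x + y) = i n x + i n y,
      forall q, exists n (x : A n), q = i n x
    & forall n m (x : A n) (y : A m), i n x = i m y <->
        exists k, [/\ (n <= k)%N, (m <= k)%N & t k x = t k y]].
Proof.
by exists dl, din; split; [exact: din_add | exact: din_surj | exact: din_eq].
Qed.

End DirectLimit.

(** * Maps of modules *)

Lemma additive_eq (U V : zmodType) (f g : {additive U -> V}) :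
  f =1 g -> f = g.
Proof.
case: f g => [f [[pf]]] [g [[pg]]] /= /funext e; subst g.
by rewrite (Prop_irrelevance pf pg).
Qed.

Section BuildAdditive.
Variables (U V : zmodType) (f : U -> V) (pf : GRing.zmod_morphism f).

HB.instance Definition _ := GRing.isZmodMorphism.Build U V f pf.
Definition build_additive : {additive U -> V} := f.

End BuildAdditive.

Section ModuleMaps.
Variable S : tricat.
Implicit Types (E F H K : smod S) (X Y Z W : S).

Lemma nt_eq E F (a b : nt E F) : (forall X x, a X x = b X x) -> a = b.
Proof.
case: a b => [a na] [b nb] /= e.
have {e} e : a = b by apply: functional_extensionality_dep => X;
  apply/additive_eq/e.
by subst b; rewrite (Prop_irrelevance na nb).
Qed.

Lemma build_nt E F (f : forall X, E X -> F X) :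
  (forall X, GRing.zmod_morphism (f X)) ->
  (forall X Y (k : hom X Y) x, f X (mmor E k x) = mmor F k (f Y x)) ->
  exists a : nt E F, forall X x, a X x = f X x.
Proof.
by move=> pf nf; exists (@NT S E F (fun X => build_additive (pf X)) nf).
Qed.

Lemma nt_compE E F H (b : nt F H) (a : nt E F) X x :
  nt_comp b a X x = b X (a X x).
Proof. by []. Qed.

Lemma yoE X Y Z (f : hom X Y) (g : hom Y Z) : mmor (yo Z) f g = g \c f.
Proof. by []. Qed.

Lemma yomE Y Z (k : hom Y Z) X (g : hom X Y) : yom k X g = k \c g.
Proof. by []. Qed.

(** Yoneda: a map out of a representable is determined by its value at the
    identity. *)
Lemma nt_yo F X (a : nt (yo X) F) W (g : hom W X) :
  a W g = mmor F g (a X (idm X)).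
Proof. by rewrite -nt_nat yoE comp1m. Qed.

Lemma nt_yo_eq F X (a b : nt (yo X) F) : a X (idm X) = b X (idm X) -> a = b.
Proof. by move=> e; apply: nt_eq => W g; rewrite (nt_yo a) (nt_yo b) e. Qed.

Lemma nt_yo_ex F X (x : F X) :
  exists a : nt (yo X) F, forall W g, a W g = mmor F g x.
Proof.
apply: (build_nt (E := yo X) (f := fun W g => mmor F g x)) => [W g g'|W W' k g].
  apply/eqP; rewrite eq_sym subr_eq -mmorD subrK; exact/eqP.
by rewrite yoE mmorM.
Qed.

Lemma mmor_iso F X Y (f : hom X Y) g x : inverse_pair f g -> mmor F f x = 0 ->
  x = 0.
Proof.
by case=> _ e fx; rewrite -(mmor1 x) -e mmorM fx raddf0.
Qed.

Lemma mod_iso G E F (a : nt E F) : (forall X x, a X x = 0 -> x = 0) ->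
  (forall X y, exists x, a X x = y) -> isomorphic (D := completion_frame G) E F.
Proof.
move=> inj surj; have ai X x y : a X x = a X y -> x = y.
  by move=> e; apply/eqP; rewrite -subr_eq0; apply/eqP/(inj X);
    rewrite raddfB e subrr.
have [b eb] : exists b : forall X, F X -> E X, forall X y, a X (b X y) = y.
  exists (fun X y => sval (cid (surj X y))) => X y;
    exact: svalP (cid (surj X y)).
have [|X Y k y|c ec] := build_nt (f := b).
- by move=> X y z; apply: ai; rewrite raddfB !eb.
- by apply: ai; rewrite nt_nat !eb.
exists a, c; split; apply: nt_eq => X x /=; rewrite nt_compE ec ?eb //.
by apply: ai; rewrite eb.
Qed.

End ModuleMaps.

(** * Colimits of sequences of representable modules *)

Section Sequences.
Variable S : tricat.
Implicit Types (X Y : sequence S) (W : S).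

(** The transition map X_n -> X_m for n <= m, with junk values for m < n. The
    cast identifies X_n with X_m when n and m are provably equal. *)
Fixpoint tr X (n m : nat) {struct m} : hom (X n) (X m) :=
  match m return hom (X n) (X m) with
  | 0 => match n return hom (X n) (X 0) with 0 => idm _ | _ => 0 end
  | m'.+1 =>
    match n =P m'.+1 with
    | ReflectT e => ecast m (hom (X n) (X m)) e (idm _)
    | ReflectF _ => smor X m' \c tr X n m'
    end
  end.

Lemma tr_id X n : tr X n n = idm _.
Proof.
case: n => //= n; case: eqP => // e.
by rewrite (eq_irrelevance e erefl).
Qed.

Lemma tr_S X n m : (n <= m)%N -> tr X n m.+1 = smor X m \c tr X n m.
Proof. by move=> le_nm /=; case: eqP => // e; rewrite e ltnn in le_nm. Qed.

Lemma tr_comp X n m k : (n <= m)%N -> (m <= k)%N ->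
  tr X m k \c tr X n m = tr X n k.
Proof.
move=> le_nm; elim: k => [|k IHk].
  by rewrite leqn0 => /eqP e; subst; rewrite tr_id comp1m.
rewrite leq_eqVlt => /predU1P[e|]; first by subst; rewrite tr_id comp1m.
rewrite ltnS => le_mk; rewrite tr_S // -compA IHk // tr_S //.
exact: leq_trans le_mk.
Qed.

Definition seq_map X Y (f : forall n, hom (X n) (Y n)) : Prop :=
  forall n, smor Y n \c f n = f n.+1 \c smor X n.

Lemma seq_map_tr X Y (f : forall n, hom (X n) (Y n)) n m :
  seq_map f -> (n <= m)%N -> tr Y n m \c f n = f m \c tr X n m.
Proof.
move=> nf; elim: m => [|m IHm].
  by rewrite leqn0 => /eqP->; rewrite !tr_id comp1m compm1.
rewrite leq_eqVlt => /predU1P[->|]; first by rewrite !tr_id comp1m compm1.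
by rewrite ltnS => le_nm; rewrite !tr_S // -compA IHm // compA nf compA.
Qed.

Lemma cocone_tr X F (c : forall n, nt (yo (X n)) F) n m W (g : hom W (X n)) :
  cocone c -> (n <= m)%N -> c m W (tr X n m \c g) = c n W g.
Proof.
move=> cc; elim: m => [|m IHm].
  by rewrite leqn0 => /eqP e; subst; rewrite tr_id comp1m.
rewrite leq_eqVlt => /predU1P[e|]; first by subst; rewrite tr_id comp1m.
rewrite ltnS => le_nm; rewrite tr_S // -compA -IHm //.
by rewrite -(cc m).
Qed.

(** Colimits computed pointwise in abelian groups; equivalent to the universal
    property, but usable elementwise. *)
Definition pw_colim X F (c : forall n, nt (yo (X n)) F) : Prop :=
  [/\ cocone c,
      forall W (x : F W), exists n (g : hom W (X n)), x = c n W g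
    & forall n W (g : hom W (X n)), c n W g = 0 ->
        exists2 m, (n <= m)%N & tr X n m \c g = 0].

(** The groups Hom(W, X_n) have a direct limit for each W, and these limits are
    functorial in W. *)
Lemma pw_colim_ex X :
  exists (F : smod S) (c : forall n, nt (yo (X n)) F), pw_colim c.
Proof.
pose A W n : zmodType := hom W (X n).
pose t W n m (g : A W n) : A W m := tr X n m \c g.
have tD W n m x y : (n <= m)%N -> t W n m (x + y) = t W n m x + t W n m y.
  by move=> _; apply: compDr.
have t1 W n (x : A W n) : t W n n x = x by rewrite /t tr_id comp1m.
have tM W n m k (x : A W n) : (n <= m)%N -> (m <= k)%N ->
    t W m k (t W n m x) = t W n k x.
  by move=> le_nm le_mk; rewrite /t compA tr_comp.
pose lim W := cid (direct_limit_ex (@tD W) (@t1 W) (@tM W)).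
have [L [i LP]] : exists (L : S -> zmodType) (i : forall W n, A W n -> L W),
    forall W, [/\ forall n (x y : A W n), i W n (x + y) = i W n x + i W n y,
      forall q, exists n (x : A W n), q = i W n x
    & forall n m (x : A W n) (y : A W m), i W n x = i W m y <->
        exists k, [/\ (n <= k)%N, (m <= k)%N & t W n k x = t W m k y]].
  exists (fun W => sval (lim W)), (fun W => sval (cid (svalP (lim W)))) => W.
  exact: (svalP (cid (svalP (lim W)))).
have iD W n x y : i W n (x + y) = i W n x + i W n y by case: (LP W).
have iS W (q : L W) : exists n (x : A W n), q = i W n x by case: (LP W).
have iE W n m (x : A W n) (y : A W m) : i W n x = i W m y <->
    exists k, [/\ (n <= k)%N, (m <= k)%N & t W n k x = t W m k y].
  by case: (LP W).
have iT W n m (x : A W n) : (n <= m)%N -> i W m (t W n m x) = i W n x.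
  by move=> le_nm; apply/iE; exists m; rewrite t1.
have iS2 W (q r : L W) : exists n (x y : A W n), q = i W n x /\ r = i W n y.
  have [n [x ->]] := iS W q; have [m [y ->]] := iS W r.
  by exists (maxn n m), (t _ _ _ x), (t _ _ _ y);
    rewrite !iT ?leq_maxl ?leq_maxr.
have iB W n (x y : A W n) : i W n (x - y) = i W n x - i W n y.
  by apply/eqP; rewrite eq_sym subr_eq -iD subrK.
have mu W' W (f : hom W' W) : exists m : {additive L W -> L W'},
    forall n (x : A W n), m (i W n x) = i W' n (x \c f).
  have [m mE] : exists m : L W -> L W',
      forall n (x : A W n), m (i W n x) = i W' n (x \c f).
    have ex (q : L W) : exists r : L W', exists n (x : A W n),
        q = i W n x /\ r = i W' n (x \c f).
      by have [n [x ->]] := iS W q; exists (i W' n (x \c f)), n, x.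
    pose m q := sval (cid (ex q)); have mE q := svalP (cid (ex q)).
    exists m => n x; rewrite /m; have [k [y [e ->]]] := mE (i W n x).
    move/iE: e => [l [nl kl e]]; apply/iE; exists l; split=> //.
    by rewrite /t !compA -/(t W k l y) -e.
  have mB : GRing.zmod_morphism m.
    by move=> q r; have [n [x [y [-> ->]]]] := iS2 _ q r;
      rewrite -iB !mE compBl iB.
  by exists (build_additive mB).
pose M W' W f := sval (cid (mu W' W f)).
have ME W' W f n x : M W' W f (i W n x) = i W' n (x \c f).
  exact: (svalP (cid (mu W' W f))).
have M1 W x : M W W (idm W) x = x.
  by have [n [g ->]] := iS W x; rewrite ME compm1.
have MM W1 W2 W3 (g : hom W2 W3) (f : hom W1 W2) x :
    M W1 W3 (g \c f) x = M W1 W2 f (M W2 W3 g x).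
  by have [n [h ->]] := iS _ x; rewrite !ME compA.
have MD W1 W2 (f f' : hom W1 W2) x :
  M W1 W2 (f + f') x = M W1 W2 f x + M W1 W2 f' x.
  by have [n [h ->]] := iS _ x; rewrite !ME compDr iD.
pose F := SMod M1 MM MD.
have c n : exists c : nt (yo (X n)) F, forall W g, c W g = i W n g.
  by apply: (@build_nt S (yo (X n)) F (fun W g => i W n g)) => [W|W W' k x];
    [exact: iB | rewrite ME].
pose C n := sval (cid (c n)).
have CE n W g : C n W g = i W n g by exact: (svalP (cid (c n))).
exists F, C; split.
- move=> n; apply: nt_eq => W g; rewrite nt_compE yomE !CE.
  apply/iE; exists n.+1; split=> //.
  by rewrite /t tr_id comp1m tr_S // tr_id compm1.
- by move=> W x; have [n [g ->]] := iS W x; exists n, g; rewrite CE.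
- move=> n W g; rewrite CE -(subrr (i W n g)) -iB subrr.
  case/iE=> k [nk _ e]; exists k => //.
  by move: e; rewrite /t compm0.
Qed.

Section Colimit.
Variables (X : sequence S) (F : smod S) (c : forall n, nt (yo (X n)) F).
Hypothesis cP : pw_colim c.

(** The element of F(X_n) corresponding to the structure map of the colimit. *)
Definition cel n : F (X n) := c n (X n) (idm (X n)).

Lemma celE n W (g : hom W (X n)) : c n W g = mmor F g (cel n).
Proof. exact: nt_yo. Qed.

Lemma cel_S n : mmor F (smor X n) (cel n.+1) = cel n.
Proof.
case: cP => cc _ _.
by rewrite -celE /cel -[in RHS](cc n) nt_compE yomE compm1.
Qed.

Lemma colim_eq n W (g g' : hom W (X n)) : c n W g = c n W g' ->
  exists2 m, (n <= m)%N & tr X n m \c g = tr X n m \c g'.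
Proof.
case: cP => _ _ ck e; have [|m le_nm] := ck n W (g - g').
  by rewrite raddfB e subrr.
rewrite compBr => /eqP; rewrite subr_eq0 => /eqP; by exists m.
Qed.

Lemma colim_common n m W (g : hom W (X n)) (h : hom W (X m)) :
  c n W g = c m W h ->
  exists k, [/\ (n <= k)%N, (m <= k)%N & tr X n k \c g = tr X m k \c h].
Proof.
case: cP => cc _ _.
rewrite -(cocone_tr g cc (leq_maxl n m)) -(cocone_tr h cc (leq_maxr n m)).
case/colim_eq=> k le_k; rewrite !compA !tr_comp ?leq_maxl ?leq_maxr // => e.
by move: le_k; rewrite geq_max => /andP[? ?]; exists k.
Qed.

Lemma colim_ext H (u v : nt F H) :
  (forall n, u (X n) (cel n) = v (X n) (cel n)) -> u = v.
Proof.
case: cP => _ cs _ e; apply: nt_eq => W x; have [n [g ->]] := cs W x.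
by rewrite celE !nt_nat e.
Qed.

(** The element represented by g : W -> X_n goes to the restriction of x_n
    along g; compatibility makes this independent of the stage. *)
Lemma colim_lift (H : smod S) (x : forall n, H (X n)) :
  (forall n, mmor H (smor X n) (x n.+1) = x n) ->
  exists u : nt F H, forall n, u (X n) (cel n) = x n.
Proof.
case: cP => cc cs ck xE.
have xT n m : (n <= m)%N -> mmor H (tr X n m) (x m) = x n.
  elim: m => [|m IHm].
    by rewrite leqn0 => /eqP e; subst; rewrite tr_id mmor1.
  rewrite leq_eqVlt => /predU1P[e|]; first by subst; rewrite tr_id mmor1.
  by rewrite ltnS => le_nm; rewrite tr_S // mmorM xE IHm.
have [u uE] : exists u : forall W, F W -> H W,
    forall W q, exists n (g : hom W (X n)), q = c n W g /\
      u W q = mmor H g (x n).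
  exists (fun W q => mmor H (sval (cid (svalP (cid (cs W q)))))
    (x (sval (cid (cs W q))))) => W q.
  exists (sval (cid (cs W q))), (sval (cid (svalP (cid (cs W q))))); split=> //.
  exact: (svalP (cid (svalP (cid (cs W q))))).
have {}uE W n (g : hom W (X n)) : u W (c n W g) = mmor H g (x n).
  have [m [h [e ->]]] := uE W (c n W g).
  have [k [nk mk ek]] := colim_common e.
  by rewrite -(xT _ _ nk) -(xT _ _ mk) -!mmorM ek.
have [|W W' k q|v vE] := build_nt (f := u).
- move=> W q r; have [n [g ->]] := cs W q; have [m [h ->]] := cs W r.
  rewrite -(cocone_tr g cc (leq_maxl n m)) -(cocone_tr h cc (leq_maxr n m)).
  rewrite -raddfB !uE; apply/eqP; rewrite eq_sym subr_eq -mmorD subrK;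
    exact/eqP.
- by have [n [g ->]] := cs _ q; rewrite -nt_nat !uE yoE mmorM.
by exists v => n; rewrite vE uE mmor1.
Qed.

Lemma pw_is_colim : is_colim c.
Proof.
split; first by case: cP.
move=> H d dc; have [|u uE] := colim_lift (x := fun n => d n (X n) (idm (X n))).
  move=> n; rewrite -nt_nat yoE comp1m.
  by rewrite -(dc n) nt_compE yomE compm1.
exists u; split=> [n|v vE].
  by apply: nt_yo_eq; rewrite nt_compE -/(cel n) uE.
by apply: colim_ext => n; rewrite uE -vE.
Qed.

End Colimit.

(** Compare with a pointwise colimit, which exists and is universal. *)
Lemma is_colim_pw X F (c : forall n, nt (yo (X n)) F) : is_colim c ->
  pw_colim c.
Proof.
move=> [cc cU]; have [F' [c' c'P]] := pw_colim_ex X.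
have [cc' cU'] := pw_is_colim c'P.
have [u [uE _]] := cU F' c' cc'; have [v [vE _]] := cU' F c cc.
have vu W x : v W (u W x) = x.
  have [w [_ wU]] := cU F c cc.
  have e1 : w = nt_comp v u.
    by apply: wU => n; apply: nt_eq => W' g;
      rewrite -[in RHS](vE n) -[in RHS](uE n).
  have e2 : w = nt_id F by apply: wU => n; apply: nt_eq.
  by rewrite -nt_compE -e1 e2.
case: c'P => _ c's c'k; split=> //.
- move=> W x; have [n [g e]] := c's W (u W x).
  by exists n, g; rewrite -vE nt_compE -e vu.
- by move=> n W g e; apply: c'k; rewrite -uE nt_compE e raddf0.
Qed.

End Sequences.

(** * Cauchy sequences and modules in the completion *)

Section SequenceOperations.
Variables (S : tricat) (ST : triangulated S) (G : S).
Implicit Types (W : S) (F H : smod S).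

Definition tail (X : sequence S) N : sequence S :=
  @Sequence S (fun n => X (n + N)%N) (fun n => smor X (n + N)%N).

Lemma tail_tr (X : sequence S) N n m : (n <= m)%N ->
  tr (tail X N) n m = tr X (n + N) (m + N).
Proof.
elim: m => [|m IHm]; first by rewrite leqn0 => /eqP e; subst; rewrite !tr_id.
rewrite leq_eqVlt => /predU1P[e|]; first by subst; rewrite !tr_id.
rewrite ltnS => le_nm; rewrite tr_S // IHm //.
by rewrite -[RHS]/(tr X (n + N) (m + N).+1) tr_S ?leq_add2r.
Qed.

Lemma tail_colim (X : sequence S) F (c : forall n, nt (yo (X n)) F) N :
  pw_colim c -> pw_colim (X := tail X N) (fun n => c (n + N)%N).
Proof.
case=> cc cs ck; split.
- by move=> n; apply: cc.
- move=> W x; have [n [g ->]] := cs W x.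
  by exists n, (tr X n (n + N) \c g); rewrite (cocone_tr _ cc) ?leq_addr.
- move=> n W g /ck[m le_m e]; exists m;
    first exact: leq_trans (leq_addr _ _) le_m.
  rewrite tail_tr; last exact: leq_trans (leq_addr _ _) le_m.
  by rewrite -(tr_comp _ le_m) ?leq_addr // -compA e compm0.
Qed.

Lemma tail_cauchy (X : sequence S) N : cauchy G X -> cauchy G (tail X N).
Proof.
move=> cX i i1; have [n nP] := cX i i1; exists n => j le_nj.
exact/nP/(leq_trans le_nj)/leq_addr.
Qed.

Definition const_seq W : sequence S := @Sequence S (fun=> W) (fun=> idm W).

Lemma const_tr W n m : (n <= m)%N -> tr (const_seq W) n m = idm W.
Proof.
elim: m => [|m IHm]; first by rewrite leqn0 => /eqP e; subst; rewrite !tr_id.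
rewrite leq_eqVlt => /predU1P[e|]; first by subst; rewrite !tr_id.
by rewrite ltnS => le_nm; rewrite tr_S // IHm // comp1m.
Qed.

Lemma const_colim W : pw_colim (X := const_seq W) (fun=> nt_id (yo W)).
Proof.
split=> [n|V x|n V g e].
- by apply: nt_eq => V g; rewrite nt_compE yomE comp1m.
- by exists 0%N, x.
- by exists n => //; rewrite const_tr // comp1m.
Qed.

Lemma const_cauchy W : cauchy G (const_seq W).
Proof.
move=> i _; exists 0%N => j _; have [O zO] := has_zero S.
by exists O; [exists 0, 0; apply: TR1_id | apply: metric_zero].
Qed.

Definition sh_seq (X : sequence S) : sequence S :=
  @Sequence S (fun n => sh (X n)) (fun n => emor sh (smor X n)).

Definition shi_seq (X : sequence S) : sequence S :=
  @Sequence S (fun n => shi (X n)) (fun n => emor shi (smor X n)).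

Lemma sh_tr (X : sequence S) n m : (n <= m)%N ->
  tr (sh_seq X) n m = emor sh (tr X n m).
Proof.
elim: m => [|m IHm].
  by rewrite leqn0 => /eqP e; subst; rewrite !tr_id emor1.
rewrite leq_eqVlt => /predU1P[e|]; first by subst; rewrite !tr_id emor1.
by rewrite ltnS => le_nm; rewrite !tr_S // IHm // emorM.
Qed.

Lemma shi_tr (X : sequence S) n m : (n <= m)%N ->
  tr (shi_seq X) n m = emor shi (tr X n m).
Proof.
elim: m => [|m IHm].
  by rewrite leqn0 => /eqP e; subst; rewrite !tr_id emor1.
rewrite leq_eqVlt => /predU1P[e|]; first by subst; rewrite !tr_id emor1.
by rewrite ltnS => le_nm; rewrite !tr_S // IHm // emorM.
Qed.

Lemma sh_cauchy (X : sequence S) : cauchy G X -> cauchy G (sh_seq X).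
Proof.
move=> cX i i1; have [n nP] := cX i i1; exists n => j /nP[C coneC MC].
exact: cone_metric_sh coneC MC.
Qed.

Lemma shi_cauchy (X : sequence S) : cauchy G X -> cauchy G (shi_seq X).
Proof.
move=> cX i i1; have [n nP] := cX i.+1 isT; exists n => j /nP[C coneC MC].
exact: cone_metric_shi coneC MC.
Qed.

Lemma yo_shE A W (g : hom W (sh A)) : yo_sh A W g = eps A \c emor shi g.
Proof. by []. Qed.

Lemma yo_sh_inj A W (g : hom W (sh A)) : yo_sh A W g = 0 -> g = 0.
Proof.
rewrite yo_shE => e; apply: shi_faithful.
have [h [h1 _]] := eps_iso A.
by rewrite -(comp1m (emor shi g)) -h1 -compA e compm0.
Qed.

Lemma yo_sh_surj A W (k : hom (shi W) A) :
  yo_sh A W (emor sh k \c eta W) = k.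
Proof. by rewrite yo_shE emorM compA -eps_nat -compA eta_eps_shi compm1. Qed.

Lemma yo_sh_natr A B W (f : hom A B) (g : hom W (sh A)) :
  yo_sh B W (emor sh f \c g) = f \c yo_sh A W g.
Proof. by rewrite !yo_shE emorM compA -eps_nat compA. Qed.

(** Hom(-, A[1]) is isomorphic to the shift of Hom(-, A), so shifting the
    sequence shifts the colimit. The structure maps are those used in the
    triangles of the completion. *)
Lemma sh_colim (X : sequence S) F (c : forall n, nt (yo (X n)) F) :
  pw_colim c ->
  pw_colim (X := sh_seq X) (F := msh F)
    (fun n => nt_comp (nt_sh (c n)) (yo_sh (X n))).
Proof.
case=> cc cs ck; split.
- move=> n; apply: nt_eq => W g; rewrite !nt_compE yomE yo_sh_natr.
  by rewrite -[in RHS](cc n).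
- move=> W x; have [n [k ->]] := cs _ x.
  by exists n, (emor sh k \c eta W); rewrite nt_compE yo_sh_surj.
- move=> n W g; rewrite nt_compE => /ck[m le_nm e]; exists m => //.
  by apply: yo_sh_inj; rewrite sh_tr // yo_sh_natr.
Qed.

Lemma shi_colim (X : sequence S) F (c : forall n, nt (yo (X n)) F) :
  pw_colim c ->
  exists c' : forall n, nt (yo (shi (X n))) (mshi F),
    pw_colim (X := shi_seq X) c'.
Proof.
move=> cP; have [cc cs ck] := cP.
pose e n := sval (cid (eta_iso (X n))).
have eP n : inverse_pair (eta (X n)) (e n) := svalP (cid (eta_iso (X n))).
have eN n : smor X n \c e n = e n.+1 \c emor sh (emor shi (smor X n)).
  rewrite -[LHS]comp1m -(proj1 (eP n.+1)) -compA (compA (eta _)) eta_nat.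
  by rewrite -compA (proj2 (eP n)) compm1.
pose x n : mshi F (shi (X n)) := mmor F (e n) (cel c n).
pose c' n := sval (cid (nt_yo_ex (x n))).
have c'E n W (g : hom W (shi (X n))) : c' n W g = c n (sh W) (e n \c emor sh g).
  by rewrite (svalP (cid (nt_yo_ex (x n)))) (celE c) mmorM.
exists c'; split.
- move=> n; apply: nt_eq => W g; rewrite nt_compE yomE !c'E emorM compA -eN.
  by rewrite -[in RHS](cc n) nt_compE yomE compA.
- move=> W y; have [n [k ->]] := cs _ y.
  have [g eg] := sh_full (eta (X n) \c k).
  by exists n, g; rewrite c'E -eg compA (proj1 (eP n)) comp1m.
- move=> n W g; rewrite c'E => /ck[m le_nm e0]; exists m => //.
  have [u [u1 u2]] := eta_iso (X n).
  apply: sh_faithful; rewrite shi_tr // emorM.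
  rewrite -(comp1m (emor sh g)) -(proj2 (eP n)) -compA compA -eta_nat.
  by rewrite -compA e0 compm0.
Qed.

Definition vanishes_on (P : S -> Prop) F : Prop :=
  forall W, P W -> forall x : F W, x = 0.

Lemma completionP (A : S -> Prop) F : completion G A F <->
  (exists2 X : sequence S, cauchy G X & (forall n, A (X n)) /\
     exists c : forall n, nt (yo (X n)) F, pw_colim c) /\
  exists j, vanishes_on (metric G j) F.
Proof.
by split=> -[[X cX [AX [c cP]]] v]; split=> //; exists X => //; split=> //;
  exists c; [apply: is_colim_pw | apply: pw_is_colim].
Qed.

Lemma completion_sub (A B : S -> Prop) F :
  (forall X, A X -> B X) -> completion G A F -> completion G B F.
Proof. by move=> AB [[X cX [AX c]] v]; split=> //; exists X => //; split=> // n;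
  apply: AB. Qed.

Lemma completion_is_all (A : S -> Prop) F : completion G A F ->
  completion_all G F.
Proof. exact: completion_sub. Qed.

Lemma completion_replete (A : S -> Prop) :
  replete (D := completion_frame G) (completion G A).
Proof.
move=> E F /completionP[[X cX [AX [c [cc cs ck]]]] [j v]].
case=> a [b [/= ba ab]].
have baE W x : b W (a W x) = x by rewrite -nt_compE ba.
have abE W x : a W (b W x) = x by rewrite -nt_compE ab.
apply/completionP; split; last first.
  by exists j => W MW x; rewrite -(abE _ x) (v _ MW (b W x)) raddf0.
exists X => //; split=> //; exists (fun n => nt_comp a (c n)); split.
- by move=> n; apply: nt_eq => W g; rewrite -[in RHS](cc n).
- move=> W x; have [n [g e]] := cs W (b W x).
  by exists n, g; rewrite nt_compE -e abE.
- by move=> n W g e; apply: ck;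
    rewrite -(baE _ (c n W g)) (e : a W (c n W g) = 0) raddf0.
Qed.

Lemma completion_sh (A B : S -> Prop) F : (forall X, A X -> B (sh X)) ->
  completion G A F -> completion G B (msh F).
Proof.
move=> AB /completionP[[X cX [AX [c cP]]] [j v]].
apply/completionP; split.
  exists (sh_seq X); first exact: sh_cauchy.
  split=> [n|]; first exact: AB.
  by exists (fun n => nt_comp (nt_sh (c n)) (yo_sh (X n))); apply: sh_colim.
by exists j.+1 => W /(metric_shi ST) MW x; apply: v MW x.
Qed.

Lemma completion_shi (A B : S -> Prop) F : (forall X, A X -> B (shi X)) ->
  completion G A F -> completion G B (mshi F).
Proof.
move=> AB /completionP[[X cX [AX [c cP]]] [j v]].
apply/completionP; split.
  exists (shi_seq X); first exact: shi_cauchy.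
  by split=> [n|]; [exact: AB | exact: (shi_colim cP)].
by exists j => W /metric_sh MW x; apply: v MW x.
Qed.

Lemma completion_yo (A : S -> Prop) W j : A W ->
  vanishes_on (metric G j) (yo W) -> completion G A (yo W).
Proof.
move=> AW v; apply/completionP; split; last by exists j.
exists (const_seq W); first exact: const_cauchy.
by split=> //; exists (fun=> nt_id (yo W)); apply: const_colim.
Qed.

(** Exactness at the middle term suffices, since triangles rotate. *)
Definition cohomological F : Prop :=
  forall (X Y Z : S) (f : hom X Y) (g : hom Y Z) (h : hom Z (sh X)),
    dist f g h ->
  forall y : F Y, mmor F f y = 0 -> exists z : F Z, y = mmor F g z.

(** Filtered colimits of exact sequences are exact: an element of F(Y) comes
    from a map Y -> X_n, and its restriction along f dies at a later stage. *)
Lemma colim_cohomological (X : sequence S) F (c : forall n, nt (yo (X n)) F) :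
  pw_colim c -> cohomological F.
Proof.
move=> cP A B C f g h d y; have [cc cs ck] := cP; have [n [k ->]] := cs _ y.
rewrite -nt_nat yoE => /ck[m le_nm]; rewrite compA => e.
have [l el] := dist_out ST d e.
by exists (c m _ l); rewrite -nt_nat yoE -el (cocone_tr _ cc).
Qed.

Lemma completion_cohomological A F : completion G A F -> cohomological F.
Proof. by move/completionP=> [[X _ [_ [c cP]]] _];
  apply: colim_cohomological cP. Qed.

Lemma yo_cohomological W : cohomological (yo W).
Proof. exact: colim_cohomological (const_colim W). Qed.

(** The obstruction to extending an element of H(X_n) along X_n -> X_{n+1} lies
    in H(C_n[-1]), where C_n is the cone; choose extensions successively. *)
Lemma colim_extend (X : sequence S) F (c : forall n, nt (yo (X n)) F) H N
  (x : H (X N)) :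
  pw_colim c -> cohomological H ->
  (forall n, (N <= n)%N -> exists2 C, cone_of (smor X n) C &
     forall y : H (shi C), y = 0) ->
  exists u : nt F H, u (X N) (cel c N) = x.
Proof.
move=> cP Hc Nc; have lift n (y : H (X (n + N)%N)) :
    exists z : H (X (n.+1 + N)%N), mmor H (smor X (n + N)%N) z = y.
  have [C [g [h d]] HC] := Nc (n + N)%N (leq_addl _ _).
  have [k [l dk]] := cone_fiber ST d.
  by have [z ->] := Hc _ _ _ _ _ _ dk y (HC _); exists z.
pose step n y := sval (cid (lift n y)).
have stepE n y : mmor H (smor X (n + N)%N) (step n y) = y :=
  svalP (cid (lift n y)).
pose xs := fix xs n : H (X (n + N)%N) := if n is m.+1 then step m (xs m) else x.
have [n|u uE] := colim_lift (tail_colim N cP) (x := xs); first exact: stepE.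
by exists u; apply: (uE 0%N).
Qed.

(** The kernel of H(X_{n+1}) -> H(X_n) is a quotient of H(C_n), so a map from
    the colimit is determined by its value at any late stage. *)
Lemma colim_unique (X : sequence S) F (c : forall n, nt (yo (X n)) F) H N
  (u v : nt F H) :
  pw_colim c -> cohomological H ->
  (forall n, (N <= n)%N -> exists2 C, cone_of (smor X n) C &
     forall y : H C, y = 0) ->
  u (X N) (cel c N) = v (X N) (cel c N) -> u = v.
Proof.
move=> cP Hc Nc e0.
have eN n : u (X (n + N)%N) (cel c (n + N)%N) = v (X (n + N)%N)
  (cel c (n + N)%N).
  elim: n => //= n IHn.
  have [C [g [h d]] HC] := Nc (n + N)%N (leq_addl _ _).
  have [|z ez] := Hc _ _ _ _ _ _ d
    (u (X (n + N).+1) (cel c (n + N).+1) - v (X (n + N).+1) (cel c (n + N).+1)).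
    by rewrite raddfB -(nt_nat u) -(nt_nat v) (cel_S cP) IHn subrr.
  by apply/eqP; rewrite -subr_eq0; apply/eqP; rewrite ez (HC z) raddf0.
apply: (colim_ext (tail_colim N cP)) => n; exact: eN.
Qed.

(** The two vanishing conditions used in [colim_unique] and [colim_extend]. *)
Lemma cauchy_vanishing (X : sequence S) H i : cauchy G X ->
  vanishes_on (metric G i) H ->
  exists N, forall n, (N <= n)%N -> exists C,
    [/\ cone_of (smor X n) C, forall y : H C, y = 0 & forall y : H (shi C),
      y = 0].
Proof.
move=> cX v; have [N NP] := cX i.+1 isT; exists N => n /NP[C coneC MC].
exists C; split=> // y; first exact: v (metric_mono (leqnSn i) MC) y.
exact: v (metric_shi ST MC) y.
Qed.

End SequenceOperations.

(** * Triangles in the completion *)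

Section CompletionTriangles.
Variables (S : tricat) (ST : triangulated S) (G : S).
Implicit Types (W : S) (A B C H : smod S).

Section OneTriangle.
Variables (A B C : smod S) (u : nt A B) (v : nt B C) (w : nt C (msh A)).
Hypothesis uvw : completion_dist G u v w.

Lemma cdist_exactY W (y : B W) : v W y = 0 -> exists x, y = u W x.
Proof.
case: uvw => _ [X [Y [Z [f [g [h [_ d nt0 [a [b [c [_ bP cP com]]]]]]]]]]].
have [bc bs bk] := is_colim_pw bP; have [cc cs ck] := is_colim_pw cP.
have [n [k ->]] := bs W y.
have vbE m l : v W (b m W l) = c m W (g m \c l).
  by have [_ e _] := com m; rewrite -[LHS]/(nt_comp v (b m) W l) e.
rewrite vbE => /ck[m le_nm]; rewrite compA (seq_map_tr (Y := Z)) //; last first.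
  by move=> i; case: (nt0 i).
rewrite -compA => /(dist_in ST (d m))[l el]; exists (a m W l).
have [e _ _] := com m; rewrite -[RHS]/(nt_comp u (a m) W l) e.
by rewrite nt_compE yomE -el (cocone_tr _ bc).
Qed.

Lemma cdist_exactZ W (z : C W) : w W z = 0 -> exists y, z = v W y.
Proof.
case: uvw => _ [X [Y [Z [f [g [h [_ d nt0 [a [b [c [aP bP cP com]]]]]]]]]]].
have [cc cs ck] := is_colim_pw cP; have [ac _ ak] := sh_colim (is_colim_pw aP).
have [n [k ->]] := cs W z.
have wcE m l : w W (c m W l) = nt_comp (nt_sh (a m)) (yo_sh (X m)) W (h m \c l).
  by have [_ _ e] := com m; rewrite -[LHS]/(nt_comp w (c m) W l) e.
rewrite wcE => /ak[m le_nm]; rewrite compA (seq_map_tr (Y := sh_seq X)) //;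
  last first.
  by move=> i; case: (nt0 i).
rewrite -compA => /(dist_in2 ST (d m))[l el]; exists (b m W l).
have [_ e _] := com m; rewrite -[RHS]/(nt_comp v (b m) W l) e.
by rewrite nt_compE yomE -el (cocone_tr _ cc).
Qed.

Lemma cdist_exactX W (x : A (shi W)) : u (shi W) x = 0 -> exists z, x = w W z.
Proof.
case: uvw => _ [X [Y [Z [f [g [h [_ d nt0 [a [b [c [aP bP cP com]]]]]]]]]]].
have [ac as_ ak] := sh_colim (is_colim_pw aP).
have [bc _ bk] := sh_colim (is_colim_pw bP).
have [n [k ->]] := as_ W x.
have uaE m l : u (shi W) (nt_comp (nt_sh (a m)) (yo_sh (X m)) W l) =
    nt_comp (nt_sh (b m)) (yo_sh (Y m)) W (emor sh (f m) \c l).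
  have [e _ _] := com m; rewrite [RHS]nt_compE yo_sh_natr.
  by rewrite -[LHS]/(nt_comp u (a m) (shi W) (yo_sh _ _ l)) e.
rewrite uaE => /bk[m le_nm].
rewrite compA (seq_map_tr (X := sh_seq X) (Y := sh_seq Y)
  (f := fun i => emor sh (f i))) //; last first.
  by move=> i /=; case: (nt0 i) => e _ _; rewrite -!emorM e.
rewrite -compA => /(dist_in3 ST (d m))[l el]; exists (c m W l).
have [_ _ e] := com m; rewrite -[RHS]/(nt_comp w (c m) W l) e.
by rewrite -[RHS]/(nt_comp (nt_sh (a m)) (yo_sh (X m)) W (h m \c l)) -el
  (cocone_tr _ ac).
Qed.

(** Fix one late stage N. The element of H(Z_N) given by k restricts to zero on
    Y_N, so it comes from H(X_N[1]); that element extends to the colimit of the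
    X_n[1], and the resulting factorisation of k holds since it holds at N. *)
Lemma cdist_out H (k : nt C H) : completion_all G H ->
  nt_comp k v = nt_zero B H -> exists l : nt (msh A) H, k = nt_comp l w.
Proof.
move=> cH kv; have Hc := completion_cohomological ST cH.
case: cH => _ [j vj].
case: uvw => _ [X [Y [Z
  [f [g [h [[cX _ cZ] d nt0 [a [b [c [aP bP cP com]]]]]]]]]]].
have [{}aP {}bP {}cP] :=
  And3 (is_colim_pw aP) (is_colim_pw bP) (is_colim_pw cP).
have [N1 NX] := cauchy_vanishing ST (sh_cauchy ST cX) vj.
have [N2 NZ] := cauchy_vanishing ST cZ vj.
pose N := maxn N1 N2.
have [|x ex] := Hc _ _ _ _ _ _ (dist_rot ST (d N)) (k (Z N) (cel c N)).
  rewrite -nt_nat -celE; have [_ e _] := com N.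
  rewrite -[g N]compm1 -[c N _ _]/(nt_comp (c N) (yom (g N)) _ (idm _)) -e.
  by rewrite -[LHS]/(nt_comp k v _ (b N _ (idm _))) kv.
have [|l lE] := colim_extend ST (X := sh_seq X) (N := N) x (sh_colim aP) Hc.
  move=> n le_Nn; have [D [coneD _ HD]] :=
    NX n (leq_trans (leq_maxl _ _) le_Nn).
  by exists D.
exists l; apply: (colim_unique (N := N) cP Hc).
  move=> n le_Nn; have [D [coneD HD _]] :=
    NZ n (leq_trans (leq_maxr _ _) le_Nn).
  by exists D.
pose a' n := nt_comp (nt_sh (a n)) (yo_sh (X n)).
rewrite ex -lE -nt_nat nt_compE; congr (l _ _).
rewrite -[LHS](celE (X := sh_seq X) a' (h N)).
have [_ _ e] := com N; rewrite -[RHS]/(nt_comp w (c N) _ (idm _)) e.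
by rewrite [in RHS]nt_compE [in RHS]nt_compE yomE compm1.
Qed.

Lemma cdist_iso : (forall W (z : C W), z = 0) ->
  isomorphic (D := completion_frame G) A B.
Proof.
move=> C0; apply: (@mod_iso S G A B u) => [W x ux|W y]; last first.
  by have [x ->] := cdist_exactY (C0 _ (v W y)); exists x.
have [e ie] := eps_iso W; apply: (mmor_iso ie).
have [|z ez] := cdist_exactX (W := sh W) (x := mmor A (eps W) x).
  by rewrite nt_nat ux raddf0.
apply: (mmor_iso (inverse_pair_id _)); rewrite mmor1.
by rewrite ez (C0 _ z) raddf0.
Qed.

End OneTriangle.

Lemma nt_sh_iso E F : isomorphic (D := completion_frame G) E F ->
  isomorphic (D := completion_frame G) (msh E) (msh F).
Proof.
move=> [a [b [/= ba ab]]]; exists (nt_sh a), (nt_sh b); split;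
  apply: nt_eq => W x.
  by rewrite -[LHS]/(nt_comp b a (shi W) x) ba.
by rewrite -[LHS]/(nt_comp a b (shi W) x) ab.
Qed.

Definition nt_shi E F (a : nt E F) : nt (mshi E) (mshi F) :=
  @NT S (mshi E) (mshi F) (fun X => a (sh X))
    (fun X Y f x => nt_nat a (emor sh f) x).

Lemma nt_shi_iso E F : isomorphic (D := completion_frame G) E F ->
  isomorphic (D := completion_frame G) (mshi E) (mshi F).
Proof.
move=> [a [b [/= ba ab]]]; exists (nt_shi a), (nt_shi b); split;
  apply: nt_eq => W x.
  by rewrite -[LHS]/(nt_comp b a (sh W) x) ba.
by rewrite -[LHS]/(nt_comp a b (sh W) x) ab.
Qed.

Lemma mshK F : isomorphic (D := completion_frame G) F (mshi (msh F)).
Proof.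
have [|X Y k x|a aE] := build_nt (E := F) (F := mshi (msh F))
    (f := fun W x => mmor F (eps W) x).
- by move=> W x y; apply: raddfB.
- by rewrite -[RHS]/(mmor F (emor shi (emor sh k)) _) -!mmorM eps_nat.
apply: (@mod_iso S G _ _ a) => [W x|W y]; have [e ie] := eps_iso W.
  by rewrite aE; apply: mmor_iso ie.
by exists (mmor F e y); rewrite aE -mmorM (proj1 ie) mmor1.
Qed.

Lemma mshiK F : isomorphic (D := completion_frame G) (msh (mshi F)) F.
Proof.
have [|X Y k x|a aE] := build_nt (E := msh (mshi F)) (F := F)
    (f := fun W x => mmor F (eta W) x).
- by move=> W x y; apply: raddfB.
- by rewrite -[mmor (msh _) k x]/(mmor F (emor sh (emor shi k)) x) -!mmorM
    eta_nat.
apply: (@mod_iso S G _ _ a) => [W x|W y]; have [e ie] := eta_iso W.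
  by rewrite aE; apply: mmor_iso ie.
by exists (mmor F e y); rewrite aE -mmorM (proj1 ie) mmor1.
Qed.

Lemma frame_laws_completion :
  frame_laws (D := completion_frame G) (completion_all G).
Proof.
split=> /=.
- by move=> *; apply: nt_eq.
- by move=> *; apply: nt_eq.
- by move=> *; apply: nt_eq.
- by move=> *; apply: nt_eq.
- by move=> X Y Z g; apply: nt_eq => W x; apply: (raddf0 (g W)).
- exact: nt_sh_iso.
- exact: nt_shi_iso.
- by move=> F; have [a [b [e1 e2]]] := mshK F; exists b, a.
- exact: mshiK.
- move=> E F n f; apply: nt_eq => W x; have [e ie] := eps_iso W.
  apply: (mmor_iso ie); rewrite -nt_nat.
  by rewrite -[LHS]/(nt_sh f (sh W) _) (n (nt_sh f)).
- move=> E F n f; apply: nt_eq => W x; have [e ie] := eta_iso W.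
  apply: (mmor_iso (inverse_pair_sym ie)); rewrite -nt_nat.
  by rewrite -[LHS]/(nt_shi f (shi W) _) (n (nt_shi f)).
- by move=> X Y Z W u v w f cW d kv; apply: (cdist_out d cW kv).
- move=> X Y Z u v w d z0; apply: (cdist_iso d) => W z.
  by rewrite -[z]/(nt_id Z W z) z0.
Qed.

End CompletionTriangles.

(** * Bounded above t-structures *)

Section DependentChoice.

Lemma dependent_sequence (T : nat -> Type) (P : forall n, T n -> Prop)
    (R : forall n, T n -> T n.+1 -> Prop) (x0 : T 0) :
  P 0 x0 -> (forall n x, P n x -> exists y, P n.+1 y /\ R n x y) ->
  exists s : forall n, T n, forall n, P n (s n) /\ R n (s n) (s n.+1).
Proof.
move=> P0 step.
pose st n (x : {x : T n | P n x}) : {y : T n.+1 | P n.+1 y} :=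
  let y := cid (step n (sval x) (svalP x)) in exist _ (sval y)
    (proj1 (svalP y)).
pose s := fix s n : {x : T n | P n x} :=
  if n is m.+1 then st m (s m) else exist _ x0 P0.
exists (fun n => sval (s n)) => n; split; first exact: svalP.
exact: (proj2 (svalP (cid (step n (sval (s n)) (svalP (s n)))))).
Qed.

End DependentChoice.

Section StableColimit.
Variables (S : tricat) (G : S).

Lemma colim_stable (X : sequence S) F (c : forall n, nt (yo (X n)) F) N :
  pw_colim c ->
  (forall n, (N <= n)%N -> exists g, inverse_pair (smor X n) g) ->
  isomorphic (D := completion_frame G) (yo (X N)) F.
Proof.
move=> cP iX; have trI m : (N <= m)%N -> exists g, inverse_pair (tr X N m) g.
  elim: m => [|m IHm].
    by rewrite leqn0 => /eqP e; subst; exists (idm _); rewrite tr_id;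
      apply: inverse_pair_id.
  rewrite leq_eqVlt => /predU1P[e|].
    by subst; exists (idm _); rewrite tr_id; apply: inverse_pair_id.
  rewrite ltnS => le_Nm; have [g [g1 g2]] := IHm le_Nm;
    have [h [h1 h2]] := iX m le_Nm.
  exists (g \c h); rewrite tr_S //; split.
    by rewrite -compA (compA h) h1 comp1m.
  by rewrite -compA (compA (tr _ _ _)) g2 comp1m.
have [cc cs ck] := cP.
apply: (@mod_iso S G _ _ (c N)) => [W g /ck[m /trI[h [h1 _]] e]|W y].
  by rewrite -(comp1m g) -h1 -compA e compm0.
have [n [k ->]] := cs W y; have [h [_ h2]] := trI _ (leq_maxr n N).
exists (h \c (tr X n (maxn n N) \c k)).
rewrite -(cocone_tr (h \c _) cc (leq_maxr n N)) compA h2 comp1m.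
by rewrite (cocone_tr _ cc) ?leq_maxl.
Qed.

End StableColimit.

(** The data of a triangle over X with third object T; it bundles the objects
    and maps chosen recursively in [completion_triangle]. *)
Record truncation (S : tricat) (T X : S) := Truncation {
  tob : S;
  tu : hom tob X;
  tv : hom X T;
  tw : hom T (sh tob) }.

Section BoundedAbove.
Variables (S : tricat) (ST : triangulated S) (G : S) (U V : S -> Prop).
Hypothesis T : t_structure (D := frame S) (fun=> True) U V.
Hypothesis BA : bounded_above (D := frame S) (fun=> True) U.
Implicit Types W : S.

Let L := frame_laws_tricat ST.
Let rU : replete (D := frame S) U := ts_le_replete T.
Let rV : replete (D := frame S) V := ts_ge_replete T.
Let QP W : True -> True := id.
Let Qsh W : True -> True := id.

Lemma aisle_in W : (forall H, V H -> hom_null (D := frame S) (sh W) H) -> U W.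
Proof. exact: (aisle_criterion0 L QP Qsh T). Qed.

Lemma aisle_out W H : U W -> V H -> hom_null (D := frame S) (sh W) H.
Proof. exact: (aisle_null L T). Qed.

Lemma aisle_shi_out W H : U (shi W) -> V H -> hom_null (D := frame S) W H.
Proof.
by move=> UW VH; apply: (hom_null_iso L) (fshiK L W) (iso_refl L H)
  (aisle_out UW VH).
Qed.

Lemma aisle_ext : ext_closed U.
Proof.
move=> A B C f g h /(dist_shE ST) d UA UC; apply: aisle_in => H VH k.
have [|l ->] := dist_out ST (k := k) d; first exact: aisle_out.
by rewrite (aisle_out UC VH l) /= comp0m.
Qed.

Lemma aisle_retract A B (r : hom B A) (i : hom A B) :
  r \c i = idm A -> U B -> U A.
Proof.
move=> ri UB; apply: aisle_in => H VH k.
by rewrite -(compm1 k) -emor1 -ri emorM compA (aisle_out UB VH (k \c _)) comp0m.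
Qed.

Lemma aisle_summand : summand_closed U.
Proof.
by move=> A B C [i1 [i2 [p1 [p2 [e _ _ _ _]]]]]; apply: aisle_retract e.
Qed.

(** G lies in some S^{<=m}, so G[m] lies in the aisle, which is closed under
    all operations generating the ball M_m. *)
Lemma metric_aisle : exists m, forall W, metric G m W -> U W.
Proof.
have [n /(tleE L n G rU) Un] := @BA G I.
exists `|n|%N => W; apply: (metric_ind (P := U)) W => [|||W].
- apply: (aisle_shift L T (m := n) (n := `|n|%N)) Un.
  exact: ler_norm.
- exact: aisle_ext.
- exact: aisle_summand.
- exact: (aisle_sh L T).
Qed.

Lemma coaisle_vanishing W : V W ->
  exists j, vanishes_on (metric G j) (yo W).
Proof.
move=> VW; have [m mU] := metric_aisle;
  exists m.+1 => A /(metric_shi ST)/mU UA g.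
exact: (aisle_shi_out UA VW g).
Qed.

Lemma coaisle_yo W : V W -> completion G V (yo W).
Proof. by move=> VW; have [j] := coaisle_vanishing VW;
  apply: completion_yo. Qed.

(** The far cones of a Cauchy sequence in S^{>=0} lie both in S^{<=-2} and in
    S^{>=-1}; hence they vanish and the sequence is eventually constant. *)
Lemma completion_coaisle F : completion G V F <-> ess_image G V F.
Proof.
split=> [/completionP[[X cX [VX [c cP]]] _]|[W VW i]]; last first.
  exact: completion_replete (coaisle_yo VW) (iso_sym i).
have [m mU] := metric_aisle; have [N NP] := cX m.+2 isT.
exists (X N) => //; apply/iso_sym/(colim_stable (N := N) _ cP) =>
  n /NP[C [g [h d]] MC].
apply: (dist_iso ST d).
(* C lies in S^{<=-2}, X_{n+1} in S^{>=0} and X_n[1] in S^{>=-1} *)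
have UC : U (shi (shi C)) by apply/mU; do 2![apply: (metric_shi ST)].
have nul A k : (k = 0 \/ k = - 1) -> V (shift (D := frame S) A k) ->
    hom_null (D := frame S) C A.
  move=> ek; apply: (aisle_coaisle_null L T (m := - 2)) => //.
  by case: ek => ->.
have [|l el] := dist_in2 ST (k := idm C) d.
  rewrite (nul _ (- 1) _ _ h) ?comp0m //; first by right.
  exact: rV (VX n) (iso_sym (fshK L (X n))).
by rewrite /is_zero el (nul _ 0 (or_introl erefl) (VX n.+1) l) compm0.
Qed.

(** If y(W) is the colimit of X_n in the aisle, then the identity of W factors
    through some X_n, so W is a retract of X_n. *)
Lemma completion_heart F :
  heart (D := completion_frame G) (completion G U) (completion G V) F <->
  ess_image G (heart (D := frame S) U V) F.
Proof.
split=> [[UF /completion_coaisle[W VW i]]|[W [UW VW] i]]; last first.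
  split; apply: completion_replete (iso_sym i).
    by have [j] := coaisle_vanishing VW; apply: completion_yo.
  exact: coaisle_yo.
exists W => //; split=> //.
case: (i) => a [b [/= ba ab]].
case/completionP: UF => [[X _ [UX [c [_ cs _]]]] _].
have [n [g e]] := cs W (b W (idm W)).
apply: (aisle_retract (r := a (X n) (c n (X n) (idm _))) (i := g) _ (UX n)).
rewrite -[LHS]yoE -!nt_nat yoE comp1m -e.
by rewrite -[LHS]/(nt_comp a b W (idm W)) ab.
Qed.

Lemma completion_null E W : completion G U E -> V W ->
  hom_null (D := completion_frame G) (msh E) (yo W).
Proof.
move=> /completionP[[X _ [UX [c cP]]] _] VW f.
apply: (colim_ext (sh_colim cP)) => n; exact: (aisle_out (UX n) VW).
Qed.

Lemma completion_iter k F : completion G (fun W => U (iter k sh W)) F ->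
  completion G U (iter k (@msh S) F).
Proof.
elim: k F => //= k IHk F cF; rewrite -iterS iterSr; apply: IHk.
by apply: (completion_sh ST) cF => W; rewrite -iterSr.
Qed.

Lemma aisle_iter_ext k : ext_closed (fun W => U (iter k sh W)).
Proof.
elim: k => [|k IHk]; first exact: aisle_ext.
move=> A B C f g h /(dist_shE ST) d; rewrite !iterSr; exact: IHk d.
Qed.

(** From some stage on all cones lie in the aisle, so the level of one X_N
    bounds the level of all later terms. *)
Lemma completion_bounded_above :
  bounded_above (D := completion_frame G) (completion_all G) (completion G U).
Proof.
move=> F cF; case: (cF) => _ vF; case/completionP: cF => [[X cX [_ [c cP]]] _].
have [m mU] := metric_aisle; have [N NP] := cX m.+1 isT.
have [n /(tleE L n _ rU) Un] := @BA (X N) I.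
exists `|n|%N; apply/(tleE (frame_laws_completion ST G)).
  exact: completion_replete.
apply: completion_iter; apply/completionP; split=> //.
exists (tail X N); first exact: tail_cauchy.
split; last by exists (fun n => c (n + N)%N); apply: tail_colim.
elim=> [|k IHk] /=.
  by apply: (aisle_shift L T (m := n) (n := `|n|%N)) Un; apply: ler_norm.
have [C [g [h d]] MC] := NP (k + N)%N (leq_addl _ _).
apply: (aisle_iter_ext d) => //.
have {}MC := metric_mono (leqnSn m) MC.
by elim: `|n|%N => [|i IHi] /=; [apply: mU | apply: (aisle_sh L T)].
Qed.

(** The truncation triangle of F = colim X_n. After dropping finitely many
    terms all cones are so negative that the coaisle part W of X_0 is the
    coaisle part of every X_n; the aisle parts are the successive fibres over
    W. *)
Lemma completion_triangle F : completion_all G F ->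
  exists E (W : S) (u : nt E F) (v : nt F (yo W)) (w : nt (yo W) (msh E)),
  [/\ completion G U (mshi E), V W & completion_dist G u v w].
Proof.
move=> cF; case: (cF) => _ [j vj].
have [m mU] := metric_aisle.
have [X [c [cX cP NP]]] :
  exists (X : sequence S) (c : forall n, nt (yo (X n)) F),
    [/\ cauchy G X, pw_colim c
      & forall n, exists C, cone_of (smor X n) C /\ metric G m.+2 C].
  case/completionP: cF => [[X cX [_ [c cP]]] _]; have [N NP] := cX m.+2 isT.
  exists (tail X N), (fun n => c (n + N)%N); split.
  - exact: tail_cauchy.
  - exact: tail_colim.
  - by move=> n; have [C ? ?] := NP (n + N)%N (leq_addl _ _); exists C.
pose C n := sval (cid (NP n)).
have coneC n : cone_of (smor X n) (C n) by case: (svalP (cid (NP n))).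
have MC n : metric G m.+2 (C n) by case: (svalP (cid (NP n))).
(* cones are unique up to isomorphism, so the chosen ones are as small as
   any *)
have cX' n i B : cone_of (smor X n) B -> metric G i B -> metric G i (C n).
  case: (coneC n) => g [h d] [g' [h' d']] MB.
  suff i0 : isomorphic (D := frame S) B (C n) by exact: metric_iso i0 MB.
  by apply: (cone_unique ST d' d (inverse_pair_id _) (inverse_pair_id _));
    rewrite comp1m compm1.
have [A [W [u0 [v0 [w0 []]]]]] := @ts_triangle _ _ _ _ T (X 0%N) I.
move=> /(tleE L (- 1) A rU) UA /(tgeE L 0 W rV) VW d0.
pose P n (t : truncation W (X n)) := dist (tu t) (tv t) (tw t) /\
  U (shi (tob t)).
pose R n (t : truncation W (X n)) (t' : truncation W (X n.+1)) :=
  exists f : hom (tob t) (tob t'),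
    [/\ smor X n \c tu t = tu t' \c f, tv t' \c smor X n = tv t,
        emor sh f \c tw t = tw t' & cone_of f (C n)].
have [||s sP] := dependent_sequence (P := P) (R := R)
  (x0 := Truncation u0 v0 w0).
- by split.
- move=> n t [dt Ut]; have [p [q dC]] := coneC n.
  have [k [l dk]] := cone_fiber ST dC.
  have UC : U (shi (C n))
    by exact: (mU _ (metric_mono (leqnSn m) (metric_shi ST (MC n)))).
  have [|r er] := dist_out ST (k := tv t) dk.
    apply: (aisle_shi_out (W := shi (C n))) => //.
    exact: (mU _ (metric_shi ST (metric_shi ST (MC n)))).
  have [A' [u' [w' [f [d' e1 e2 coneF]]]]] := fiber_step ST dt dC (esym er).
  exists (Truncation u' r w'); split; last by exists f.
  split=> //=; case: coneF => g [h /(dist_shi ST)[i di]].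
  exact: aisle_ext di Ut UC.
have sd n : dist (tu (s n)) (tv (s n)) (tw (s n)) by case: (sP n) => [[]].
have sU n : U (shi (tob (s n))) by case: (sP n) => [[]].
pose f n := sval (cid (proj2 (sP n))).
have fP n : [/\ smor X n \c tu (s n) = tu (s n.+1) \c f n,
    tv (s n.+1) \c smor X n = tv (s n), emor sh (f n) \c tw (s n) = tw (s n.+1)
  & cone_of (f n) (C n)] := svalP (cid (proj2 (sP n))).
pose X' : sequence S := @Sequence S (fun n => tob (s n)) f.
have cX'' : cauchy G X'.
  move=> i i1; have [n nP] := cX i i1; exists n => k /nP[B cB MB].
  by exists (C k); [case: (fP k) | apply: cX' cB MB].
have [E [a aP]] := pw_colim_ex X'.
have aP' := sh_colim aP; set a' := (fun n => nt_comp _ _) in aP'.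
have [|u uE] := colim_lift aP (x := fun n => c n _ (tu (s n))).
  move=> n; have [e _ _ _] := fP n; rewrite -nt_nat yoE -e.
  by case: cP => cc _ _; rewrite -[in RHS](cc n).
have [|v vE] := colim_lift cP (H := yo W) (x := fun n => tv (s n)).
  by move=> n; have [_ e _ _] := fP n.
have [w wE] := nt_yo_ex (a' 0 _ (tw (s 0)) : msh E W).
have wn n : a' n _ (tw (s n)) = a' 0 _ (tw (s 0)).
  elim: n => // n <-; have [_ _ e _] := fP n.
  by case: aP' => ac _ _; rewrite -e -[in RHS](ac n).
(* E lies between F and a shift of y(W), both of which kill a ball *)
have vE' : vanishes_on (metric G (maxn j m.+1)) E.
  move=> B MB x; have [ac as_ _] := aP; have [n [k ->]] := as_ B x.
  have e0 : c n B (tu (s n) \c k) = 0.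
    rewrite -[LHS]/(c n B (mmor (yo (X n)) k (tu (s n)))) nt_nat -uE -nt_nat
      -celE.
    exact: vj (metric_mono (leq_maxl _ _) MB) _.
  case: (cP) => _ _ ck; move: e0.
  case/ck => l le_nl; rewrite compA
    (seq_map_tr (X := X') (Y := X) (f := fun i => tu (s i))) //; last first.
    by move=> i; case: (fP i).
  rewrite -compA => e.
  have [|z ez] := dist_in3 ST (k := emor sh (tr X' n l \c k)) (sd l).
    by rewrite -emorM e emor0.
  have UB : U B by exact:
    (mU _ (metric_mono (leqnSn m) (metric_mono (leq_maxr j m.+1) MB))).
  have k0 : tr X' n l \c k = 0.
    by apply: sh_faithful; rewrite ez (aisle_out UB VW z) compm0.
  by rewrite -(cocone_tr _ ac le_nl) k0 raddf0.
exists E, W, u, v, w; split=> //.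
  apply: (completion_shi ST (A := fun B => U (shi B))) => //.
  apply/completionP; split; last by exists (maxn j m.+1).
  by exists X' => //; split=> //; exists a.
split; first split=> //.
- apply/completionP; split; last by exists (maxn j m.+1).
  by exists X' => //; split=> //; exists a.
- exact: (completion_is_all (coaisle_yo VW)).
exists X', X, (const_seq W), (fun n => tu (s n)), (fun n => tv (s n)),
  (fun n => tw (s n)).
split=> //.
- by split=> //; apply: const_cauchy.
- by move=> n; have [e1 e2 e3 _] := fP n; split; rewrite /= ?comp1m ?compm1.
exists a, c, (fun=> nt_id (yo W)); split.
- exact: pw_is_colim.
- exact: pw_is_colim.
- exact/pw_is_colim/const_colim.
- move=> n; split; apply: nt_yo_eq; rewrite !nt_compE.
  + by rewrite -/(cel a n) uE yomE compm1.
  + by rewrite -/(cel c n) vE yomE compm1.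
  + by rewrite wE mmor1 -(wn n) yomE compm1.
Qed.

End BoundedAbove.

Section CompletionTStructure.
Variables (S : tricat) (ST : triangulated S) (G : S) (U V : S -> Prop).
Hypothesis T : t_structure (D := frame S) (fun=> True) U V.
Hypothesis BA : bounded_above (D := frame S) (fun=> True) U.
Implicit Types W : S.

Let LC := frame_laws_completion ST G.

Lemma completion_t_structure :
  t_structure (D := completion_frame G) (completion_all G)
    (completion G U) (completion G V).
Proof.
have rU := @completion_replete S G U; have rV := @completion_replete S G V.
split=> //.
- by move=> F; apply: completion_is_all.
- by move=> F; apply: completion_is_all.
- move=> F /(tleE LC _ _ rU) UF; apply/(tleE LC _ _ rU).
  apply: rU _ (@mshiK S G F).
  exact: completion_sh (aisle_sh (frame_laws_tricat ST) T) UF.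
- move=> F /(tgeE LC _ _ rV) VF; apply/(tgeE LC _ _ rV).
  exact: completion_shi (coaisle_shi (frame_laws_tricat ST) T) VF.
- move=> F H /(tleE LC _ _ rU) UF /(tgeE LC _ _ rV) VH.
  have [W VW i] := proj1 (completion_coaisle ST G T BA H) VH.
  apply: (hom_null_iso LC (@mshiK S G F) (iso_sym i)).
  exact: (completion_null ST T UF VW).
- move=> F /(completion_triangle ST T BA)[E [W [u [v [w [UE VW d]]]]]].
  exists E, (yo W), u, v, w; split=> //; first exact/(tleE LC _ _ rU).
  exact/(tgeE LC _ _ rV)/(coaisle_yo ST G T BA).
Qed.

End CompletionTStructure.

(** * Vanishing of modules and shifts of representables *)

Section Null.
Variables (S : tricat) (ST : triangulated S) (G : S).
Implicit Types (W : S) (F H : smod S).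

Definition null_at H W : Prop := forall x : H W, x = 0.

Lemma null_at_iso H W W' :
  isomorphic (D := frame S) W W' -> null_at H W -> null_at H W'.
Proof. by case=> f [g i] n x; apply: (mmor_iso i); apply: n. Qed.

Lemma null_at_msh H k W : null_at (iter k (@msh S) H) W <->
  null_at H (iter k shi W).
Proof. elim: k W => // k IHk W; rewrite (iterSr k shi W); exact: IHk. Qed.

Lemma null_at_mshi H k W : null_at (iter k (@mshi S) H) W <->
  null_at H (iter k sh W).
Proof. elim: k W => // k IHk W; rewrite (iterSr k sh W); exact: IHk. Qed.

Lemma null_at_yo H W : hom_null (D := completion_frame G) (yo W) H ->
  null_at H W.
Proof.
by move=> n x; have [a aE] := nt_yo_ex x; rewrite -(mmor1 x) -aE (n a).
Qed.

Lemma yo_iso W W' : isomorphic (D := frame S) W W' ->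
  isomorphic (D := completion_frame G) (yo W) (yo W').
Proof.
case=> f [g [/= e1 e2]]; exists (yom f), (yom g).
by split; apply: nt_eq => A h; rewrite nt_compE !yomE compA (e1, e2) comp1m.
Qed.

Lemma yo_msh W : isomorphic (D := completion_frame G) (yo (sh W)) (msh (yo W)).
Proof.
apply: (@mod_iso S G _ _ (yo_sh W)) => A x; first exact: yo_sh_inj.
by exists (emor sh x \c eta A); apply: yo_sh_surj.
Qed.

Lemma yo_shift W k : isomorphic (D := completion_frame G)
  (shift (D := completion_frame G) (yo W) k) (yo (shift (D := frame S) W k)).
Proof.
have LC := frame_laws_completion ST G; have L := frame_laws_tricat ST.
case: k => n /=; first elim: n => [|n IHn] /=.
- exact: (iso_refl LC).
- exact: (iso_trans LC) (nt_sh_iso IHn) (iso_sym (yo_msh _)).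
have yo_mshi A : isomorphic (D := completion_frame G) (mshi (yo A))
  (yo (shi A)).
  apply: (iso_trans LC _ (iso_sym (@mshK S G (yo (shi A))))). 
  apply: nt_shi_iso; apply: (iso_trans LC _ (yo_msh (shi A))).
  exact: yo_iso (iso_sym (fshiK L A)).
elim: n => [|n IHn] /=; first exact: yo_mshi.
exact: (iso_trans LC) (nt_shi_iso IHn) (yo_mshi _).
Qed.

Lemma shift_sh W (n : nat) : shift (D := frame S) W n = iter n sh W.
Proof. by []. Qed.

Lemma shift_shi W (n : nat) : shift (D := frame S) W (- n%:Z) = iter n shi W.
Proof. by case: n. Qed.

Lemma shift_mshi F (n : nat) :
  shift (D := completion_frame G) F (- n%:Z) = iter n (@mshi S) F.
Proof. by case: n. Qed.

Lemma metric_iter_shi i n W : metric G (n + i) W -> metric G i (iter n shi W).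
Proof.
elim: n W => //= n IHn W /(metric_shi ST)/IHn.
by rewrite -iterSr.
Qed.

End Null.

(** * Bounded t-structures and finitistic dimension *)

Section Bounded.
Variables (S : tricat) (ST : triangulated S) (G : S) (U V : S -> Prop).
Hypothesis T : t_structure (D := frame S) (fun=> True) U V.
Hypothesis BA : bounded_above (D := frame S) (fun=> True) U.
Hypothesis BB : bounded_below (D := frame S) (fun=> True) V.
Implicit Types W : S.

Let L := frame_laws_tricat ST.
Let LC := frame_laws_completion ST G.
Let rU : replete (D := frame S) U := ts_le_replete T.
Let rV : replete (D := frame S) V := ts_ge_replete T.

(** A lower bound for W makes Hom(M_j, W) vanish for large j. *)
Lemma yo_completion W : completion_all G (yo W).
Proof.
have [m mU] := metric_aisle ST G T BA; have [n] := @BB W I.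
move=> /(tgeE L _ _ rV) VW.
apply: (completion_yo ST (j := (`|n|.+1 + m)%N)) => // A MA g.
apply: (aisle_coaisle_null L T (m := - `|n|.+1%:Z) (n := - n)) g => //.
- by rewrite ltrN2 -addn1 PoszD ltzD1; apply: ler_norm.
- by rewrite shift_shi; exact: (mU _ (metric_iter_shi ST MA)).
Qed.

(** Since F kills a ball M_j, it kills the aisle shifted by e, so F' = F[-b]
    kills the aisle for large b. Truncate F' as E -> F' -> y(W). At Y[1], with
    Y in the aisle, every element of E vanishes in F', so it comes from
    Hom(Y[2], W) = 0. As E is a colimit of representables of such objects, E =
    0. *)
Lemma findim_ess_image F : findim (S := op S) G <> None ->
  completion_all G F -> ess_image G (fun=> True) F.
Proof.
case/(findim_op_perp ST) => d dP cF.
have [n /(tgeE L _ _ rV) VG] := @BB G I.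
have [_ [j vj]] := cF.
(* G is in S^{>=-n}; the summand d + j makes room for the shift by [-d] in the
   orthogonality statement and for the passage from M_0 to M_j *)
set e := (- n - (d + j)%:Z)%R.
have null_low Y : U (shift (D := frame S) Y e) -> null_at F Y.
  move=> UY; have [|W MW iW] := dP (shift (D := frame S) Y (- (d + j)%:Z)).
    move=> k k0; apply: (aisle_coaisle_null L T (m := - n) (n := - n + k%:Z)).
    - by rewrite ltrDl ltz_nat.
    - by apply: rU UY (iso_sym _); apply: (shift_addE L); rewrite addrC.
    - rewrite -shift_shi; apply: rV VG (iso_sym _).
      by apply: (shift_addE L); rewrite addrCA addNr addr0.
  have MjW : metric G j (iter j sh W) by exact (metric_iter ST MW).
  apply: (null_at_iso (W := iter j sh W)); last exact: vj MjW.
  rewrite -shift_shi in iW; have := shift_iso L (d + j)%:Z iW => i2.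
  apply: (iso_trans L (Y :=
    shift (D := frame S) (shift (D := frame S) W (- d%:Z)) (d + j)%:Z)).
    apply: iso_sym; rewrite -shift_sh; apply: (shift_addE L).
    by rewrite PoszD addrA addNr add0r.
  apply: (iso_trans L) (iso_sym i2) _.
  by apply: (@shift_addE _ _ L _ _ _ 0); rewrite addNr.
pose b := `|e|%N; pose F' := iter b (@mshi S) F.
have cF' : completion_all G F'.
  have all_iter k : completion_all G (iter k (@mshi S) F).
    elim: k => //= k IHk; exact: (completion_shi ST (A := fun=> True)) IHk.
  exact: all_iter.
have null_F' Y : U Y -> null_at F' Y.
  move=> UY; apply/null_at_mshi/null_low.
  apply: (aisle_shift L T (m := - b%:Z)); first by rewrite lerNl;
    have := ler_norm (- e); rewrite normrN.
  apply: rU UY (iso_sym _); rewrite -shift_sh;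
    apply: (@shift_addE _ _ L _ _ _ 0).
  by rewrite subrr.
have [E [W [u [v [w [UE VW tri]]]]]] := completion_triangle ST T BA cF'.
have E_sh Y : U Y -> null_at E (sh Y).
  move=> UY; apply: (null_at_iso (fshK L (sh Y))) => x.
  have [|z ->] := cdist_exactX ST tri (W := sh (sh Y)) (x := x).
    apply: null_F'; apply: rU (iso_sym (fshK L (sh Y))).
    exact: (aisle_sh L T).
  by rewrite (aisle_out ST T (aisle_sh L T UY) VW z) raddf0.
have E0 A : null_at E A.
  apply: (null_at_iso (fshiK L A)) => x.
  case/completionP: UE => [[X _ [UX [c [_ cs _]]]] _].
  have [l [k ->]] := cs (shi A) (x : mshi E (shi A)).
  by rewrite celE (E_sh _ (UX l) (cel c l)) raddf0.
have iF' : isomorphic (D := completion_frame G) F' (yo W).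
  apply: (@mod_iso S G _ _ v) => [A x vx|A y].
    by have [z ->] := cdist_exactY ST tri vx; rewrite (E0 _ z) raddf0.
  have [|x ->] := cdist_exactZ ST tri (z := y); first exact: E0.
  by exists x.
exists (shift (D := frame S) W b) => //.
have := shift_iso LC b%:Z iF' => i2.
apply: (iso_trans LC _ (yo_shift ST G W b)); apply: (iso_trans LC _ i2).
apply: iso_sym; have := @shift_add _ _ LC F (- b%:Z) b%:Z.
by rewrite addNr /= shift_mshi.
Qed.

End Bounded.

(** * Equivalence of bounded t-structures *)

Section Equivalence.
Variables (S : tricat) (ST : triangulated S) (G : S) (Q : smod S -> Prop).
Implicit Types (W : S) (F H : smod S).
Let L := frame_laws_tricat ST.
Let LC := frame_laws_completion ST G.
Hypothesis TQ : triangulated_subcategory (D := completion_frame G)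
  (completion_all G) Q.
Hypothesis SQ : forall F : smod S, ess_image G (fun=> True) F -> Q F.

Let QP F : Q F -> completion_all G F.
Proof. by case: TQ => QC _ _ _ _; apply: QC. Qed.

Let Qsh F : Q F -> Q (msh F).
Proof. by case: TQ => _ _ _ Qs _ /Qs[]. Qed.

Let Qshift F k : Q F -> Q (shift (D := completion_frame G) F k).
Proof.
case: TQ => _ _ _ Qs _ QF.
by case: k => n /=; [|apply: (proj2 (Qs _ _))]; elim: n => //= n /Qs[].
Qed.

Let Qyo W : Q (yo W).
Proof. by apply: SQ; exists W => //; apply: (iso_refl LC). Qed.

Section OneTStructure.
Variables U V : smod S -> Prop.
Hypothesis T : t_structure (D := completion_frame G) Q U V.

Let rU : replete (D := completion_frame G) U := ts_le_replete T.
Let rV : replete (D := completion_frame G) V := ts_ge_replete T.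

Lemma coaisle_in_Q H c : V (shift (D := completion_frame G) H c) -> Q H.
Proof.
move=> VH; case: TQ => _ rQ _ _ _.
apply: rQ (Qshift (- c) (ts_ge_sub T VH)) _.
by apply: (@shift_addE _ _ LC _ _ _ 0); rewrite subrr.
Qed.

(** For fixed i the property is stable under the generating operations of M_i;
    a positive shift of the object trades for a negative shift of H. *)
Lemma metric_null (b : int) i A :
  U (shift (D := completion_frame G) (yo G) b) ->
  metric G i A -> forall H (c : int), b - i%:Z < c ->
  V (shift (D := completion_frame G) H c) -> null_at H A.
Proof.
move=> UG MA.
pose P A := forall H (c : int), b - i%:Z < c ->
  V (shift (D := completion_frame G) H c) -> null_at H A.
apply: (metric_ind (P := P)) MA =>
  [H c bc VH|X Y Z f g h d PX PZ H c bc VH y||Y PY H c bc VH].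
- apply: (null_at_yo (G := G)).
  apply: (aisle_coaisle_null LC T bc) VH.
  apply: rU UG (iso_sym _).
  apply: (iso_trans LC) (shift_iso LC _ (iso_sym (yo_shift ST G G i))) _.
  by apply: (shift_addE LC); rewrite addrC subrK.
- have Hc := completion_cohomological ST (QP (coaisle_in_Q VH)).
  have [|z ->] := Hc _ _ _ _ _ _ d y; first exact: PX bc VH _.
  by rewrite (PZ _ _ bc VH z) raddf0.
- move=> X Y Z [i1 [i2 [p1 [p2 [e _ _ _ _]]]]] PZ H c bc VH x.
  by rewrite -(mmor1 x) -e mmorM (PZ _ _ bc VH (mmor H p1 x)) raddf0.
- apply: (PY (mshi H) (c + 1)); first by rewrite (lt_trans bc) // ltrDl.
  apply: rV VH (iso_sym _).
  by apply: (@shift_addE _ _ LC H (-1)); rewrite addrCA addNr addr0.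
Qed.

End OneTStructure.

(** The index p is a lower bound for G in the first t-structure, b2 an upper
    bound for G in the second one, and d comes from the finitistic
    dimension. *)
Lemma aisle_bound U1 V1 U2 V2 : findim (S := op S) G <> None ->
  bounded_t_structure (D := completion_frame G) Q U1 V1 ->
  bounded_t_structure (D := completion_frame G) Q U2 V2 ->
  exists e f : int, forall F, U1 (shift (D := completion_frame G) F e) ->
    U2 (shift (D := completion_frame G) F f).
Proof.
case/(findim_op_perp ST) => d dP [T1 BA1 BB1] [T2 BA2 BB2].
have [rU1 rV1] := (ts_le_replete T1, ts_ge_replete T1).
have [rU2 rV2] := (ts_le_replete T2, ts_ge_replete T2).
have [b1 /(tleE LC b1 _ rU1) U1G] := BA1 _ (Qyo G).
have [b2 /(tleE LC b2 _ rU2) U2G] := BA2 _ (Qyo G).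
have [n1 /(tgeE LC (- n1) _ rV1) V1G] := BB1 _ (Qyo G).
set p := - n1 in V1G.
exists p, (b2 + d%:Z) => F U1F.
have QF : Q F.
  case: TQ => _ rQ _ _ _; apply: rQ (Qshift (- p) (ts_le_sub T1 U1F)) _.
  by apply: (@shift_addE _ _ LC _ _ _ 0); rewrite subrr.
have VGk k : V1 (shift (D := completion_frame G) (yo (iter k shi G))
  (p + k%:Z)).
  apply: rV1 V1G (iso_sym _); rewrite -shift_shi.
  apply: (iso_trans LC) (shift_iso LC _ (iso_sym (yo_shift ST G G _))) _.
  by apply: (shift_addE LC); rewrite addrCA addNr addr0.
case/completionP: (QP QF) => [[X cX [_ [c cP]]] _].
pose i := `|b1 - p|%N.
(* cones in M_{i+1}, desuspended, have no map to any G[-k] with k > 0 *)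
have [N NP] := cX i.+1 isT.
have X_perp n : (N <= n)%N -> exists2 W, metric G 0 W &
    isomorphic (D := frame S) (X n) (iter d shi W).
  move=> le_Nn; apply: dP => k k0 g.
  have [|m le_nm|u uE] := colim_extend ST (H := yo (iter k shi G)) g cP.
  - exact: yo_cohomological.
  - have [C coneC MC] := NP m (leq_trans le_Nn le_nm).
    exists C => //; apply: (metric_null T1 U1G (metric_shi ST MC)) (VGk k).
    apply: (@le_lt_trans _ _ p); last by rewrite ltrDl ltz_nat.
    by rewrite lerBlDr addrC -lerBlDr; apply: ler_norm.
  rewrite -uE (aisle_coaisle_null LC T1 _ U1F (VGk k) u) //.
  by rewrite ltrDl ltz_nat.
apply: (aisle_criterion LC QP Qsh T2) => [|H VH u]; first exact: Qshift.
apply: (colim_ext (tail_colim N cP)) => n /=.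
have [W MW iW] := X_perp (n + N)%N (leq_addl _ _).
suff n0 : null_at H (X (n + N)%N) by exact: n0.
apply: (null_at_iso (iso_sym iW)); apply/null_at_msh.
apply: (metric_null T2 U2G MW (c := b2 + 1)); first by rewrite subr0 ltrDl.
apply: rV2 VH (iso_sym _); apply: (@shift_addE _ _ LC H d%:Z).
by rewrite addrA [d%:Z + b2]addrC.
Qed.

Lemma bounded_equivalent U1 V1 U2 V2 : findim (S := op S) G <> None ->
  bounded_t_structure (D := completion_frame G) Q U1 V1 ->
  bounded_t_structure (D := completion_frame G) Q U2 V2 ->
  t_equivalent (D := completion_frame G) U1 U2.
Proof.
move=> fd B1 B2.
have [e [f ef]] := aisle_bound fd B1 B2.
have [e' [f' ef']] := aisle_bound fd B2 B1.
case: B1 B2 => [T1 _ _] [T2 _ _].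
have [rU1 rU2] := (ts_le_replete T1, ts_le_replete T2).
have transfer U U' (rU : replete (D := completion_frame G) U)
    (rU' : replete (D := completion_frame G) U') (a b : int) :
    (forall F, U (shift (D := completion_frame G) F a) ->
               U' (shift (D := completion_frame G) F b)) ->
    forall k F, U (shift (D := completion_frame G) F (k + a)) ->
                U' (shift (D := completion_frame G) F (k + b)).
  move=> H k F UF; apply: rU' (H _ _) (shift_add LC F k b).
  exact: rU UF (iso_sym (shift_add LC F k a)).
exists (`|e - f| + `|f' - e'|)%N; split=> F.
- move=> /(tleE LC _ _ rU1) UF; apply/(tleE LC _ _ rU2).
  have := transfer _ _ rU1 rU2 _ _ ef (- f) F; rewrite addNr; apply.
  apply: (aisle_shift LC T1) UF.
  rewrite lerNl opprD opprK; apply: le_trans (ler_norm _) _.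
  by rewrite PoszD -normrN opprB lerDl.
- move=> /(tleE LC _ _ rU2) UF; apply/(tleE LC _ _ rU1).
  have := transfer _ _ rU2 rU1 _ _ ef' (- e') F; rewrite addNr => /(_ UF).
  apply: (aisle_shift LC T1).
  rewrite [- e' + f']addrC; apply: le_trans (ler_norm _) _.
  by rewrite PoszD lerDr.
Qed.

End Equivalence.

(** * The completion and its t-structures *)

Theorem theorem3p11 (S : tricat) (S_triangulated : triangulated S)
    (S_small : essentially_small S) (G : S) :
  (forall U V : S -> Prop,
     bounded_above_t_structure (D := frame S) (fun _ => True) U V ->
     bounded_above_t_structure (D := completion_frame G)
       (completion_all G) (completion G U) (completion G V) /\
     (forall F : smod S,
        heart (D := completion_frame G) (completion G U) (completion G V) F
        <-> ess_image G (heart (D := frame S) U V) F)) /\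
  (forall U V : S -> Prop,
     bounded_t_structure (D := frame S) (fun _ => True) U V ->
     (forall F : smod S,
        ess_image G (fun _ => True) F -> completion_all G F) /\
     (findim (S := op S) G <> None ->
      forall F : smod S,
        ess_image G (fun _ => True) F <-> completion_all G F)) /\
  (findim (S := op S) G <> None ->
   forall Q : smod S -> Prop,
     triangulated_subcategory (D := completion_frame G) (completion_all G) Q ->
     (forall F : smod S, ess_image G (fun _ => True) F -> Q F) ->
     forall U1 V1 U2 V2 : smod S -> Prop,
       bounded_t_structure (D := completion_frame G) Q U1 V1 ->
       bounded_t_structure (D := completion_frame G) Q U2 V2 ->
       t_equivalent (D := completion_frame G) U1 U2).
Proof.
split; [|split].
- move=> U V [T BA]; split; last exact: (completion_heart S_triangulated T BA).
  split; first exact: (completion_t_structure S_triangulated G T BA).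
  exact: (completion_bounded_above S_triangulated T BA).
- move=> U V [T BA BB].
  have ess_all F : ess_image G (fun _ => True) F -> completion_all G F.
    case=> W _ i; apply: (completion_replete _ (iso_sym i)).
    exact: (yo_completion S_triangulated G T BA BB).
  split=> // fd F; split; first exact: ess_all.
  exact: (findim_ess_image S_triangulated T BA BB fd).
- move=> fd Q TQ SQ U1 V1 U2 V2.
  exact: (bounded_equivalent S_triangulated TQ SQ fd).
Qed.
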